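(* Let $G_1$ and $G_2$ be finite graphs, viewed as metric graphs with all edges of length $1$. Consider the optimal scale factor $\alpha$, the smallest $\alpha>0$ such that $G_1$ with every edge length multiplied by $\alpha$ can be folded onto $G_2$ via an isometric covering. This $\alpha$ is a rational number.
   Context: A metric graph is viewed as a metric space in which each edge is a segment of its length, glued at the vertices. An isometric covering (folding) of $Y$ by $X$ is a surjective map $m:X\to Y$ such that, for every path $p$ in $X$, the arc length of $p$ equals the arc length of the curve $m(p)$ in $Y$, counted with multiplicity. *)

(* Defs.v *)
From HB Require Import structures.
From mathcomp Require Import all_boot all_order all_algebra.
From mathcomp Require Import classical_sets reals ereal.
Set Implicit Arguments. Unset Strict Implicit. Unset Printing Implicit Defensive.
Import Order.TTheory GRing.Theory Num.Theory.
Local Open Scope ring_scope.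
Local Open Scope classical_set_scope.

Record fin_mgraph := FGraph { gV : finType; gE : finType; gends : gE -> gV * gV }.

Section MetricGraph.
Variables (R : realType) (G : fin_mgraph).

(* Raw points of the metric graph: a vertex, or an interior point of an edge e
   at relative position t (0 < t < 1) from its first endpoint. *)
Inductive mpoint := MV of gV G | ME of gE G & R.

Definition mvalid (x : mpoint) : bool :=
  match x with MV _ => true | ME _ t => (0 < t) && (t < 1) end.

(* Points of the metric graph (each point has a unique representation). *)
Definition point := {x : mpoint | mvalid x}.

Definition gadj (u w : gV G) : bool :=
  [exists e, (gends e == (u, w)) || (gends e == (w, u))].

Definition vdist (L : R) (a b : gV G) : \bar R :=
  ereal_inf ((fun n : nat => ((n%:R * L)%:E)%E) @`
    [set n : nat | exists s : seq (gV G),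
        [/\ size s = n, path gadj a s & last a s = b]]).

(* Ways of leaving a point towards a vertex, with the distance travelled. *)
Definition anchors (L : R) (x : mpoint) : seq (gV G * R) :=
  match x with
  | MV v => [:: (v, 0)]
  | ME e t => [:: ((gends e).1, t * L); ((gends e).2, (1 - t) * L)]
  end.

Definition mdist (L : R) (x y : mpoint) : \bar R :=
  ereal_inf [set c : \bar R |
    (exists a b, [/\ a \in anchors L x, b \in anchors L y &
        c = (a.2%:E + vdist L a.1 b.1 + b.2%:E)%E])
    \/ (exists e t t', [/\ x = ME e t, y = ME e t' & c = (`|t - t'| * L)%:E])].

Definition pdist (L : R) (x y : point) : \bar R := mdist L (sval x) (sval y).

Definition is_path (L : R) (p : R -> point) : Prop :=
  forall t, 0 <= t <= 1 -> forall eps : R, 0 < eps -> exists delta : R,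
    0 < delta /\ forall s, 0 <= s <= 1 -> `|s - t| < delta ->
      (pdist L (p s) (p t) < eps%:E)%E.

Definition arclen (L : R) (p : R -> point) : \bar R :=
  ereal_sup [set c : \bar R | exists r : seq R,
    [/\ path <%R 0 r, last 0 r = 1 &
        c = (\sum_(i < size r) pdist L (p (nth 0%R (0%R :: r) i)) (p (nth 0%R r i)))%E]].

End MetricGraph.

Arguments point R G : clear implicits.

Definition isometric_covering (R : realType) (X Y : fin_mgraph) (LX LY : R)
    (m : point R X -> point R Y) : Prop :=
  (forall y, exists x, m x = y) /\
  (forall p : R -> point R X, is_path LX p -> arclen LX p = arclen LY (m \o p)).

Definition foldable_scale (R : realType) (G1 G2 : fin_mgraph) (alpha : R) : Prop :=
  0 < alpha /\ exists m : point R G1 -> point R G2,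
    isometric_covering alpha 1 m.

(* Main.v *)
(** A folding restricts to an [alpha]-Lipschitz curve on every edge of [G1], so
    each edge can be replaced by a finite chain of straight segments of [G2] of
    total length at most [alpha] with the same ends and covering the same points.
    Conversely such chains, padded with small wiggles up to length [alpha], give a
    folding, because folds are allowed anywhere.  If [alpha] were irrational, there
    would be a [Q]-linear [Q : R -> rat] with [Q 1 = 0] and [Q alpha = 1]; replacing
    every coordinate [t] of the finite data by [t - eps * Q t] preserves incidences
    and order, hence the covering, and moves the constraint [length <= alpha] to
    [length <= alpha - eps], contradicting minimality. *)
From Pilot Require (* [topology] exports its own [point] and [mdist]. *)
Import Defs.
From mathcomp Require Import all_boot all_order all_algebra.
From mathcomp Require Import boolp classical_sets functions reals ereal.
From mathcomp Require Import topology normedtype derive lra ring.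
(* [topology] exports its own [point] and [mdist]. *)
Import Defs.
Import Order.TTheory GRing.Theory Num.Theory.
Import numFieldNormedType.Exports.
Set Implicit Arguments. Unset Strict Implicit. Unset Printing Implicit Defensive.
Local Open Scope ring_scope.
Local Open Scope classical_set_scope.

(** Two obstacles shape the proof. An edge may be folded infinitely often, so its image is a priori
    only a Lipschitz curve. But small balls of the target are stars, and of all the places that the
    curve visits on one ray only the farthest matters: going through these finitely many extremes in
    order of time, by shortest moves, is no longer than the Lipschitz bound allows and covers at
    least as much. Compactness of [[0, 1]] then glues the local chains. On the other side,
    [t - eps * Q t] is discontinuous and controlled only on finitely many coordinates, so coverage
    cannot be transported point by point: a target point is exchanged for one in the same order
    position among the breakpoints, and coverage is read off there. *)

Lemma le_ereal_inf_add (R : realType) (A B : set \bar R) (u : \bar R) :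
  (forall p, A p -> 0%E <= p)%E -> (forall q, B q -> 0%E <= q)%E ->
  (forall p q, A p -> B q -> u <= p + q)%E ->
  (u <= ereal_inf A + ereal_inf B)%E.
Proof.
move=> A0 B0 uAB.
have iA : (0 <= ereal_inf A)%E by apply: le_ereal_inf_tmp.
have iB : (0 <= ereal_inf B)%E by apply: le_ereal_inf_tmp.
(* Infinite infima do occur: vertices of different components are at distance [+oo]. *)
have [->|fA] := eqVneq (ereal_inf A) +oo%E.
  by rewrite addye ?leey// gt_eqF// (lt_le_trans _ iB)// ltNy0.
have [->|fB] := eqVneq (ereal_inf B) +oo%E.
  by rewrite addey ?leey// gt_eqF// (lt_le_trans _ iA)// ltNy0.
have finA : ereal_inf A \is a fin_num by rewrite ge0_fin_numE// ltey.
have finB : ereal_inf B \is a fin_num by rewrite ge0_fin_numE// ltey.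
apply/lee_addgt0Pr => e e0.
have e2 : 0 < e / 2 by lra.
have [p Ap pl] := lb_ereal_inf_adherent e2 finA.
have [q Bq ql] := lb_ereal_inf_adherent e2 finB.
apply: (le_trans (uAB _ _ Ap Bq)).
apply: (le_trans (leeD (ltW pl) (ltW ql))).
by rewrite addeACA -EFinD -splitr.
Qed.

(** * The path metric of a metric graph *)

Section Distance.
Variables (R : realType) (G : fin_mgraph) (L : R).
Hypothesis L0 : 0 < L.
Implicit Types x y z : mpoint R G.

Lemma vdist_ge0 (a b : gV G) : (0 <= vdist L a b)%E.
Proof.
by apply: le_ereal_inf_tmp => _ [n _ <-]; rewrite lee_fin mulr_ge0 ?ler0n ?ltW.
Qed.

Lemma vdist_le (a : gV G) s : path (@gadj G) a s ->
  (vdist L a (last a s) <= ((size s)%:R * L)%:E)%E.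
Proof.
by move=> ps; apply: ereal_inf_lbound; exists (size s) => //; exists s.
Qed.

Lemma vdist_xx (a : gV G) : vdist L a a = 0%E.
Proof.
apply/le_anti; rewrite vdist_ge0 andbT.
by have := @vdist_le a [::] isT; rewrite /= mul0r.
Qed.

Lemma vdist_ge (a b : gV G) : a != b -> (L%:E <= vdist L a b)%E.
Proof.
move=> ab; apply: le_ereal_inf_tmp => _ [n [s [sn _ sb]] <-].
rewrite lee_fin -[leLHS]mul1r ler_wpM2r ?(ltW L0)// ler1n -sn.
by case: s sb {sn} => //= ab'; rewrite ab' eqxx in ab.
Qed.

Lemma gadj_sym : symmetric (@gadj G).
Proof. by move=> a b; apply: eq_existsb => e; rewrite orbC. Qed.

Lemma vdist_le_sym (a b : gV G) : (vdist L a b <= vdist L b a)%E.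
Proof.
apply: le_ereal_inf_tmp => _ [n [s [<- ps <-]] <-].
have := @vdist_le (last b s) (rev (belast b s)).
rewrite rev_path size_rev size_belast (eq_path (e' := @gadj G)); last first.
  by move=> ? ?; rewrite gadj_sym.
move=> /(_ ps); suff -> : last (last b s) (rev (belast b s)) = b by [].
by case: s {ps} => //= u s; rewrite rev_cons last_rcons.
Qed.

Lemma vdist_sym (a b : gV G) : vdist L a b = vdist L b a.
Proof. by apply/le_anti; rewrite !vdist_le_sym. Qed.

Lemma vdist_triangle (b a c : gV G) : (vdist L a c <= vdist L a b + vdist L b c)%E.
Proof.
apply: le_ereal_inf_add.
- by move=> _ [n _ <-]; rewrite lee_fin mulr_ge0 ?ler0n ?ltW.
- by move=> _ [n _ <-]; rewrite lee_fin mulr_ge0 ?ler0n ?ltW.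
move=> _ _ [n [s [<- ps sb]] <-] [m [t [<- pt <-]] <-].
have := @vdist_le a (s ++ t).
rewrite cat_path ps sb pt last_cat sb size_cat natrD mulrDl EFinD; exact.
Qed.

Lemma vdist_edge (e : gE G) : (vdist L (gends e).1 (gends e).2 <= L%:E)%E.
Proof.
have := @vdist_le (gends e).1 [:: (gends e).2]; rewrite /= andbT mul1r; apply.
by apply/existsP; exists e; rewrite -surjective_pairing eqxx.
Qed.

Lemma mdist_anchor_le x y a b : a \in anchors L x -> b \in anchors L y ->
  (mdist L x y <= a.2%:E + vdist L a.1 b.1 + b.2%:E)%E.
Proof. by move=> ha hb; apply: ereal_inf_lbound; left; exists a, b. Qed.

Lemma mdist_direct_le e t t' :
  (mdist L (ME e t : mpoint R G) (ME e t') <= (`|t - t'| * L)%:E)%E.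
Proof. by apply: ereal_inf_lbound; right; exists e, t, t'. Qed.

Lemma mdist_ge (r : \bar R) x y :
  (forall a b, a \in anchors L x -> b \in anchors L y ->
     (r <= a.2%:E + vdist L a.1 b.1 + b.2%:E)%E) ->
  (forall e t t', x = ME e t -> y = ME e t' -> (r <= (`|t - t'| * L)%:E)%E) ->
  (r <= mdist L x y)%E.
Proof.
move=> h1 h2; apply: le_ereal_inf_tmp => r' [[a [b [ha hb rE]]]|].
  by subst r'; exact: h1.
by move=> [e [t [t' [hx hy rE]]]]; subst r'; exact: h2 hx hy.
Qed.

Lemma anchor_ge0 x a : mvalid x -> a \in anchors L x -> 0 <= a.2.
Proof.
case: x => [v _|e t /= /andP[t0 t1]].
  by rewrite inE => /eqP->.
by rewrite !inE => /orP[/eqP->|/eqP->] /=; rewrite mulr_ge0 ?ltW// subr_gt0.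
Qed.

Lemma mdist_ge0 x y : mvalid x -> mvalid y -> (0 <= mdist L x y)%E.
Proof.
move=> vx vy; apply: mdist_ge => [a b ha hb|e t t' _ _].
  by rewrite !adde_ge0 ?vdist_ge0// lee_fin ?(anchor_ge0 vx ha) ?(anchor_ge0 vy hb).
by rewrite lee_fin mulr_ge0 ?(ltW L0).
Qed.

Lemma mdist_le_sym x y : (mdist L x y <= mdist L y x)%E.
Proof.
apply: mdist_ge => [a b ha hb|e t t' -> ->]; last by rewrite distrC mdist_direct_le.
have := mdist_anchor_le hb ha.
by rewrite vdist_sym addeC [X in (_ <= _ + X)%E]addeC addeA.
Qed.

Lemma mdist_sym x y : mdist L x y = mdist L y x.
Proof. by apply/le_anti; rewrite !mdist_le_sym. Qed.

Lemma mdist_xx x : (mdist L x x <= 0)%E.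
Proof.
case: x => [v|e t]; last by have := mdist_direct_le e t t; rewrite subrr normr0 mul0r.
have v0 : (v, 0 : R) \in anchors L (MV R v) by rewrite inE.
by have := mdist_anchor_le v0 v0; rewrite /= vdist_xx !adde0.
Qed.

(** In the triangle inequality a route may enter [y] through one anchor and leave through another;
    the detour through [y] is then at least as long as the way between the two vertices. *)
Lemma anchor_detour y a b : mvalid y -> a \in anchors L y -> b \in anchors L y ->
  (vdist L a.1 b.1 <= (a.2 + b.2)%:E)%E.
Proof.
case: y => [v _|e t /= /andP[t0 t1]].
  by rewrite !inE => /eqP-> /eqP->; rewrite vdist_xx lee_fin /= addr0.
have tL : 0 < t * L by rewrite mulr_gt0.
have sL : 0 < (1 - t) * L by rewrite mulr_gt0 // subr_gt0.
have ve := vdist_edge e.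
have E : t * L + (1 - t) * L = L by rewrite -mulrDl addrC subrK mul1r.
rewrite !inE => /orP[]/eqP-> /orP[]/eqP->; rewrite /= ?vdist_xx ?lee_fin ?E//.
- by rewrite addr_ge0// ltW.
- by rewrite addrC E vdist_sym.
- by rewrite addr_ge0// ltW.
Qed.

(** Sliding along the edge from [t] to [t'] before walking to an end saves nothing. This settles the
    mixed cases of the triangle inequality, one route within an edge and one through vertices. *)
Lemma anchor_shift e t t' b : b \in anchors L (ME e t' : mpoint R G) ->
  exists2 a, a \in anchors L (ME e t : mpoint R G) &
    a.1 = b.1 /\ a.2 <= `|t - t'| * L + b.2.
Proof.
rewrite !inE => /orP[]/eqP->.
  exists ((gends e).1, t * L); rewrite ?inE ?eqxx//=; split=> //.
  rewrite -mulrDl ler_wpM2r ?(ltW L0)//; have := ler_norm (t - t'); lra.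
exists ((gends e).2, (1 - t) * L); rewrite ?inE ?eqxx ?orbT//=; split=> //.
rewrite -mulrDl ler_wpM2r ?(ltW L0)//; have := ler_norm (t' - t); rewrite distrC; lra.
Qed.

Lemma mdist_triangle y x z : mvalid x -> mvalid y -> mvalid z ->
  (mdist L x z <= mdist L x y + mdist L y z)%E.
Proof.
move=> vx vy vz; apply: le_ereal_inf_add.
- move=> r hr; apply: le_trans (mdist_ge0 vx vy) _; exact: ereal_inf_lbound.
- move=> r hr; apply: le_trans (mdist_ge0 vy vz) _; exact: ereal_inf_lbound.
move=> r r' [[a [b [ha hb rE]]]|[e [t [t' [xE yE rE]]]]]
  [[b' [c [hb' hc r'E]]]|[e' [s [s' [yE' zE r'E]]]]]; subst r r'.
- apply: le_trans (mdist_anchor_le ha hc) _.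
  have := vdist_triangle b.1 a.1 c.1; have := vdist_triangle b'.1 b.1 c.1.
  have := anchor_detour vy hb hb'.
  move: (vdist_ge0 a.1 c.1) (vdist_ge0 b.1 c.1) (vdist_ge0 b.1 b'.1).
  move: (vdist_ge0 a.1 b.1) (vdist_ge0 b'.1 c.1).
  case: (vdist L a.1 c.1) => [r1| |]; case: (vdist L b.1 c.1) => [r2| |];
  case: (vdist L b.1 b'.1) => [r3| |]; case: (vdist L a.1 b.1) => [r4| |];
  case: (vdist L b'.1 c.1) => [r5| |] //= h1 h2 h3 h4 h5 h6 h7 h8; try exact: leey.
  by move: h6 h7 h8; rewrite -!EFinD !lee_fin; lra.
- subst y z; have [a' ha' [E le]] := anchor_shift s' hb.
  apply: le_trans (mdist_anchor_le ha ha') _.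
  by rewrite E -[leRHS]addeA leeD2l// -EFinD lee_fin (le_trans le)// distrC addrC.
- subst x y; have [a ha' [E le]] := anchor_shift t hb'.
  apply: le_trans (mdist_anchor_le ha' hc) _; rewrite E.
  by rewrite !addeA leeD2r// leeD2r// -EFinD lee_fin.
- subst x y z; case: yE' => ? ?; subst e' s.
  apply: le_trans (mdist_direct_le e t s') _.
  by rewrite -EFinD lee_fin -mulrDl ler_wpM2r ?(ltW L0)// ler_distD.
Qed.

End Distance.

(** * Edge coordinates and small balls *)

Section Points.
Variables (R : realType) (G : fin_mgraph).

Lemma point_inj : injective (@sval _ (fun x : mpoint R G => mvalid x)).
Proof.
move=> [x hx] [y hy] /= xy; subst y; congr exist; exact: bool_irrelevance.
Qed.

(** [mvalid] excludes [ME e 0] and [ME e 1], so the ends of an edge must be turned into vertices. *)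
Definition edge_mpoint (e : gE G) (t : R) : mpoint R G :=
  if t <= 0 then MV R (gends e).1 else if 1 <= t then MV R (gends e).2 else ME e t.

Lemma edge_mpoint_valid e t : mvalid (edge_mpoint e t).
Proof.
by rewrite /edge_mpoint; case: ltP => //= t0; case: leP => //= t1; rewrite t0 t1.
Qed.

(* The coordinate [t] is clamped to [0, 1]. *)
Definition edge_point (e : gE G) (t : R) : point R G :=
  exist (fun x : mpoint R G => mvalid x) _ (edge_mpoint_valid e t).

Lemma edge_mpoint_interior e t : 0 < t < 1 -> edge_mpoint e t = ME e t.
Proof. by move=> /andP[t0 t1]; rewrite /edge_mpoint !leNgt t0 t1. Qed.

Lemma edge_mpoint0 e : edge_mpoint e 0 = MV R (gends e).1.
Proof. by rewrite /edge_mpoint lexx. Qed.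

Lemma edge_mpoint1 e : edge_mpoint e 1 = MV R (gends e).2.
Proof. by rewrite /edge_mpoint lexx leNgt ltr01. Qed.

Lemma edge_mpoint_ME e t e' t' : edge_mpoint e t = ME e' t' -> e = e' /\ t = t'.
Proof. by rewrite /edge_mpoint; case: ifP => // _; case: ifP => // _ []. Qed.

Lemma edge_mpointP (t : R) : 0 <= t <= 1 -> [\/ t = 0, t = 1 | 0 < t < 1].
Proof.
move=> /andP[]; rewrite le_eqVlt => /predU1P[<-|t0]; first by constructor 1.
by rewrite le_eqVlt => /predU1P[->|t1]; [constructor 2|constructor 3; apply/andP].
Qed.

Variable L : R.
Hypothesis L0 : 0 < L.
Implicit Types x y z : point R G.

Lemma pdist_sym x y : pdist L x y = pdist L y x.
Proof. exact: mdist_sym. Qed.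

Lemma pdist_ge0 x y : (0 <= pdist L x y)%E.
Proof. apply: mdist_ge0 => //; [exact: (svalP x)|exact: (svalP y)]. Qed.

Lemma pdist_xx x : pdist L x x = 0%E.
Proof. by apply/le_anti; rewrite pdist_ge0 andbT mdist_xx. Qed.

Lemma pdist_triangle y x z : (pdist L x z <= pdist L x y + pdist L y z)%E.
Proof.
by apply: mdist_triangle => //; [exact: (svalP x)|exact: (svalP y)|exact: (svalP z)].
Qed.

Lemma anchor_sum_le (a b : gV G * R) (r : R) : r <= a.2 + b.2 ->
  (r%:E <= a.2%:E + vdist L a.1 b.1 + b.2%:E)%E.
Proof.
have := vdist_ge0 L0 a.1 b.1; case: (vdist L a.1 b.1) => [v| |] //= v0 rab.
  by move: v0; rewrite -!EFinD !lee_fin; lra.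
exact: leey.
Qed.

Lemma anchor_far_le (a b : gV G * R) (r : R) : a.1 != b.1 -> r <= a.2 + L + b.2 ->
  (r%:E <= a.2%:E + vdist L a.1 b.1 + b.2%:E)%E.
Proof.
move=> /(vdist_ge L0); case: (vdist L a.1 b.1) => [v| |] //= v0 rab.
  by move: v0; rewrite -!EFinD !lee_fin; lra.
exact: leey.
Qed.

Lemma edge_anchorP e t a : 0 <= t <= 1 -> a \in anchors L (edge_mpoint e t) ->
  a = ((gends e).1, t * L) \/ a = ((gends e).2, (1 - t) * L).
Proof.
move=> /edge_mpointP[->|->|t01].
- by rewrite edge_mpoint0 inE mul0r => /eqP->; left.
- by rewrite edge_mpoint1 inE subrr mul0r => /eqP->; right.
by rewrite edge_mpoint_interior// !inE => /orP[]/eqP->; [left|right].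
Qed.

(** The value [t = 1] is excluded because the point is then a vertex, whose only anchor is itself at
    distance 0. *)
Lemma edge_anchor1 e t : 0 <= t < 1 ->
  ((gends e).1, t * L) \in anchors L (edge_mpoint e t).
Proof.
move=> /andP[]; rewrite le_eqVlt => /predU1P[<- _|t0 t1].
  by rewrite edge_mpoint0 mul0r inE.
by rewrite edge_mpoint_interior ?t0// inE eqxx.
Qed.

Lemma edge_anchor2 e t : 0 < t <= 1 ->
  ((gends e).2, (1 - t) * L) \in anchors L (edge_mpoint e t).
Proof.
move=> /andP[t0]; rewrite le_eqVlt => /predU1P[->|t1].
  by rewrite edge_mpoint1 subrr mul0r inE.
by rewrite edge_mpoint_interior ?t0// !inE eqxx orbT.
Qed.

Lemma edge_point_dist_le e s t : 0 <= s <= 1 -> 0 <= t <= 1 ->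
  (pdist L (edge_point e s) (edge_point e t) <= (`|s - t| * L)%:E)%E.
Proof.
wlog st : s t / s <= t => [hw s01 t01|].
  have [|/ltW] := leP s t => st; first exact: hw.
  by rewrite pdist_sym distrC; exact: hw.
move=> s01 t01; rewrite distrC ger0_norm ?subr_ge0// /pdist /=.
have [s0|s0] := eqVneq s 0; last first.
  have [t1|t1] := eqVneq t 1; last first.
    rewrite !edge_mpoint_interior; [|lra|lra].
    by have := mdist_direct_le L e s t; rewrite distrC (ger0_norm (x := t - s)) ?subr_ge0.
  have [s1|s1] := eqVneq s 1.
    by rewrite s1 t1 subrr mul0r; exact: mdist_xx.
  have := mdist_anchor_le (@edge_anchor2 e s _) (@edge_anchor2 e t _).
  rewrite /= vdist_xx// adde0 -EFinD t1 subrr mul0r addr0; apply; lra.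
have [t1|t1] := eqVneq t 1; last first.
  have := mdist_anchor_le (@edge_anchor1 e s _) (@edge_anchor1 e t _).
  rewrite /= vdist_xx// adde0 -EFinD s0 mul0r add0r subr0; apply; lra.
have := mdist_anchor_le (@edge_anchor1 e s _) (@edge_anchor2 e t _).
rewrite s0 t1 !subrr subr0 mul0r mul1r adde0 add0e => h.
by apply: (le_trans (h _ _)); [lra|lra|exact: vdist_edge].
Qed.

(** The bound [1 / 2] comes from loops: beyond it the way round through the common vertex is shorter
    than the way along the edge. *)
Lemma edge_point_dist e s t : 0 <= s <= 1 -> 0 <= t <= 1 -> `|s - t| <= 1 / 2 ->
  pdist L (edge_point e s) (edge_point e t) = (`|s - t| * L)%:E.
Proof.
move=> s01 t01 st; apply/le_anti; rewrite edge_point_dist_le//=.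
apply: mdist_ge => [a b ha hb|e' s' t' /edge_mpoint_ME[_ <-] /edge_mpoint_ME[_ <-]//].
apply: anchor_sum_le; move: st; rewrite ler_norml => st.
have E (u v : R) : u <= v -> u * L <= v * L by move=> ?; rewrite ler_wpM2r ?(ltW L0).
have [sE|sE] := lerP 0 (s - t).
  rewrite (ger0_norm sE).
  by case: (edge_anchorP s01 ha) => ->; case: (edge_anchorP t01 hb) => -> /=;
    rewrite -mulrDl E//; lra.
rewrite (ltr0_norm sE).
by case: (edge_anchorP s01 ha) => ->; case: (edge_anchorP t01 hb) => -> /=;
    rewrite -mulrDl E//; lra.
Qed.

(** Only isolated vertices have no edge coordinate, and a finite route from [x] to another point has
    to use an edge at [x]. *)
Lemma finite_dist_edge x y : (pdist L x y < +oo)%E -> x <> y ->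
  exists e t, 0 <= t <= 1 /\ x = edge_point e t.
Proof.
move=> /ereal_inf_lt[r hr roo] xy.
case: x hr xy => -[v|e t] vx hr xy; last first.
  exists e, t; split; first by move: (vx) => /= ?; lra.
  by apply: point_inj; rewrite /= edge_mpoint_interior.
have E e : v = (gends e).1 \/ v = (gends e).2 ->
    exists e t, 0 <= t <= 1 /\
      exist (fun x : mpoint R G => mvalid x) (MV R v) vx = edge_point e t.
  move=> [vE|vE].
    exists e, 0; split; first by lra.
    by apply: point_inj; rewrite /= edge_mpoint0 vE.
  exists e, 1; split; first by lra.
  by apply: point_inj; rewrite /= edge_mpoint1 vE.
case: hr => [|[e [t [t' [//]]]]] [a [b [/=]]]; rewrite inE => /eqP -> /= hb rE.
have : (vdist L v b.1 < +oo)%E.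
  by move: roo; rewrite rE add0e; case: (vdist _ _ _) => [d| |]//= _; exact: ltry.
move=> /ereal_inf_lt[_ [n [[|u s] [_ /= ps sb] <-]] _]; last first.
  move: ps => /andP[/existsP[e /orP[]/eqP ee] _]; apply: (E e); rewrite ee; [left|right] => //.
case: y xy hb => -[w|e t] vy xy /=.
  by rewrite inE => /eqP bE; case: xy; apply: point_inj; rewrite /= sb bE.
by rewrite !inE => /orP[]/eqP bE; apply: (E e); rewrite sb bE; [left|right].
Qed.

Lemma sval_ME x e t : sval x = ME e t -> 0 < t < 1 /\ x = edge_point e t.
Proof.
move=> xE; have t01 : 0 < t < 1 by have := svalP x; rewrite xE.
by split=> //; apply: point_inj; rewrite /= edge_mpoint_interior.
Qed.

(** A route through a second vertex costs at least [L], so a smaller ball meets only the edges at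
    [v]. The last two cases separate the two ends of a loop. *)
Lemma near_vertex (v : gV G) x y (r : R) : sval y = MV R v -> r <= L ->
  (pdist L y x < r%:E)%E ->
  [\/ x = y,
      exists e t, [/\ (gends e).1 = v, sval x = ME e t & t * L < r] |
      exists e t, [/\ (gends e).2 = v, sval x = ME e t & (1 - t) * L < r]].
Proof.
rewrite /pdist => yv rL; rewrite yv => /ereal_inf_lt[r' [[a [b [ha hb rE]]]|[e [s [s' [//]]]]]].
move: ha rE; rewrite inE => /eqP -> /= rE.
rewrite rE add0e; have [vb|vb] := eqVneq v b.1; last first.
  rewrite ltNge => /negP[].
  have := @anchor_far_le (v, 0) b r vb; rewrite add0e; apply => /=.
  by have := anchor_ge0 L0 (svalP x) hb; move: (b.2) => u; lra.
rewrite vb vdist_xx// add0e lte_fin => bL.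
case: x hb {rE} => -[w|e s] vz /=; rewrite ?inE.
  by move=> /eqP bE; constructor 1; apply: point_inj; rewrite yv vb bE.
by move=> /orP[]/eqP bE; move: bL; rewrite bE /= => bL;
  [constructor 2|constructor 3]; exists e, s.
Qed.

(** Leaving the edge costs at least [Num.min t (1 - t) * L]. Half of this radius also keeps any two
    points of the ball within [1 / 2] of each other, as [edge_point_dist] requires. *)
Lemma near_interior (e : gE G) (t : R) x : 0 < t < 1 ->
  (pdist L (edge_point e t) x < (Num.min t (1 - t) / 2 * L)%:E)%E ->
  exists s, [/\ 0 < s < 1, `|s - t| < Num.min t (1 - t) / 2 & sval x = ME e s].
Proof.
move=> t01; have m0 : 0 < Num.min t (1 - t) by rewrite lt_min; lra.
rewrite /pdist /= edge_mpoint_interior// => /ereal_inf_lt[r hr].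
case: hr => [[a [b [ha hb ->]]]|[e' [s [s' [[<- <-] xE ->]]]]].
  have ra : Num.min t (1 - t) * L <= a.2.
    by move: ha; rewrite !inE => /orP[]/eqP->; rewrite ler_wpM2r ?(ltW L0)// ge_min lexx ?orbT.
  have rL : 0 < Num.min t (1 - t) * L by rewrite mulr_gt0.
  rewrite ltNge => /negP[]; apply: anchor_sum_le.
  by have := anchor_ge0 L0 (svalP x) hb; move: ra; move: (a.2) (b.2) => u w; lra.
rewrite lte_fin ltr_pM2r// distrC => st.
by exists s'; split=> //; case: (sval_ME xE).
Qed.

End Points.

(** * Polar coordinates around a point *)

Section StarChart.
Variables (R : realType) (G : fin_mgraph).
Implicit Types x y z : point R G.

Definition ray (base : gE G * bool -> R) (h : gE G * bool) (s : R) : R :=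
  base h + (-1) ^+ h.2 * s.

(* Polar coordinates around [y]: a point [z] near [y] lies at distance [ht z]
   from [y] along the half-edge [dir z] issued from the coordinate [base (dir z)]
   of [y]; the boolean tells whether the edge coordinate decreases. *)
Definition star_chart y (rho : R) (dir : point R G -> gE G * bool)
    (base : gE G * bool -> R) (ht : point R G -> R) : Prop :=
  (forall z, (pdist 1 y z < rho%:E)%E ->
     [/\ 0 <= ht z, 0 <= base (dir z) <= 1, edge_point (dir z).1 (base (dir z)) = y,
         0 <= ray base (dir z) (ht z) <= 1
       & edge_point (dir z).1 (ray base (dir z) (ht z)) = z]) /\
  (forall z z', (pdist 1 y z < rho%:E)%E -> (pdist 1 y z' < rho%:E)%E ->
     ((if dir z == dir z' then `|ht z - ht z'| else ht z + ht z')%:E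
       <= pdist 1 z z')%E) /\
  ht y = 0.

Let edge_dist (e : gE G) (s t : R) : 0 <= s <= 1 -> 0 <= t <= 1 ->
  `|s - t| <= 1 / 2 -> pdist 1 (edge_point e s) (edge_point e t) = `|s - t|%:E.
Proof. by move=> s01 t01 st; rewrite edge_point_dist// mulr1. Qed.

Lemma star_chart_interior (e : gE G) (t : R) : 0 < t < 1 ->
  exists rho dir base ht, 0 < rho /\ star_chart (edge_point e t) rho dir base ht.
Proof.
move=> t01.
pose rho := Num.min t (1 - t) / 2.
have mt : Num.min t (1 - t) <= t by rewrite ge_min lexx.
have mt' : Num.min t (1 - t) <= 1 - t by rewrite ge_min lexx orbT.
have m0 : 0 < Num.min t (1 - t) by rewrite lt_min; lra.
pose coord z := if sval z is ME _ s then s else t.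
pose dir z := (e, coord z < t).
pose ht z := `|coord z - t|.
exists rho, dir, (fun=> t), ht.
have near z : (pdist 1 (edge_point e t) z < rho%:E)%E ->
    [/\ 0 < coord z < 1, `|coord z - t| < rho & z = edge_point e (coord z)].
  move=> tz; have [|s [s01 st zE]] := @near_interior R G 1 ltr01 e t z t01.
    by rewrite mulr1.
  by rewrite /coord zE; case: (sval_ME zE).
split; first by rewrite /rho; lra.
split; [|split] => [z /near[c01 cr zE]|z z' /near[c01 cr zE] /near[c01' cr' zE']|];
  last by rewrite /ht /coord /= edge_mpoint_interior// subrr normr0.
  have rE : ray (fun=> t) (dir z) (ht z) = coord z.
    rewrite /ray /dir /ht /=; case: ltP => zt.
      by rewrite ltr0_norm ?subr_lt0// expr1; lra.
    by rewrite ger0_norm ?subr_ge0// expr0; lra.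
  by rewrite rE /dir/= -zE; split; rewrite // ?/ht ?normr_ge0//; lra.
have cc : `|coord z - coord z'| <= 1 / 2.
  move: cr cr'; rewrite ler_norml !ltr_norml /rho; lra.
rewrite [in leRHS]zE [in leRHS]zE' edge_dist//; [|lra|lra].
rewrite lee_fin xpair_eqE eqxx /= /ht.
have below (u : R) : u < t -> `|u - t| = t - u.
  by move=> ut; rewrite ltr0_norm ?subr_lt0// opprB.
have above (u : R) : t <= u -> `|u - t| = u - t.
  by move=> ut; rewrite ger0_norm ?subr_ge0.
case: (ltP (coord z)) => [/below|/above] ->;
  case: (ltP (coord z')) => [/below|/above] -> /=.
- by rewrite distrC (_ : _ - _ = coord z - coord z')//; lra.
- by rewrite distrC (le_trans _ (ler_norm _))//; lra.
- by rewrite (le_trans _ (ler_norm _))//; lra.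
- by rewrite (_ : _ - _ = coord z - coord z')//; lra.
Qed.

Lemma star_chart_vertex (e : gE G) (t : R) : t = 0 \/ t = 1 ->
  exists rho dir base ht, 0 < rho /\ star_chart (edge_point e t) rho dir base ht.
Proof.
move=> t01; set y := edge_point e t.
have [v yv] : exists v, sval y = MV R v.
  case: t01 => tE; [exists (gends e).1|exists (gends e).2];
  by rewrite /y tE /= ?edge_mpoint0 ?edge_mpoint1.
(* An interior point is assigned to the nearer end of its edge. The centre itself also needs a
   half-edge issued from it, and [e] with its end [t] provides one. *)
pose dir (z : point R G) :=
  if sval z is ME e' s then (e', 1 / 2 < s) else (e, 1 / 2 < t).
pose base (h : gE G * bool) : R := (h.2 : nat)%:R.
pose ht (z : point R G) := if sval z is ME _ s then Num.min s (1 - s) else 0.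
(* Within radius [1 / 4], two points near opposite ends of one loop are at least [1 / 2] apart along
   the loop, which is at least the sum of their heights. *)
exists (1 / 4), dir, base, ht.
have ht_anchor (z : point R G) a : a \in anchors 1 (sval z) -> ht z <= a.2.
  rewrite /ht; case: (sval z) => [w|e' s] /=; first by rewrite inE => /eqP->.
  by rewrite !inE !mulr1 => /orP[]/eqP->; rewrite /= ge_min lexx ?orbT.
have ht_ge0 (z : point R G) : 0 <= ht z.
  rewrite /ht; case: z => -[w|e' s] //= /andP[s0 s1].
  by rewrite le_min !ltW// subr_gt0.
have near (z : point R G) : (pdist 1 y z < (1 / 4 : R)%:E)%E ->
    [\/ z = y,
        exists e' s, [/\ (gends e').1 = v, sval z = ME e' s & 0 < s < 1 / 4] |
        exists e' s, [/\ (gends e').2 = v, sval z = ME e' s & 3 / 4 < s < 1]].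
  move=> yz; have [|->|[e' [s [ev zE s1]]]|[e' [s [ev zE s1]]]] :=
    near_vertex ltr01 yv _ yz; [lra|by constructor 1|constructor 2|constructor 3];
    by exists e', s; split=> //; have [s01 _] := sval_ME zE; lra.
have vertex_eq e' (s : R) : edge_mpoint e' s = MV R v -> edge_point e' s = y.
  by move=> h; apply: point_inj; rewrite yv.
have ht_le (z : point R G) : (pdist 1 y z < (1 / 4 : R)%:E)%E -> ht z <= 1 / 4.
  move=> yz; case: (near _ yz) => [zE|[e' [s [_ zE s01]]]|[e' [s [_ zE s01]]]].
  - by rewrite zE /ht yv; lra.
  - by rewrite /ht zE; have := ge_min s s (1 - s); rewrite lexx/=; lra.
  - by rewrite /ht zE; have := ge_min (1 - s) s (1 - s); rewrite lexx orbT/=; lra.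
split; first lra.
split; [|split] => [z yz|z z' yz yz'|]; last by rewrite /ht yv.
  case: (near _ yz) => [->|[e' [s [ev zE s01]]]|[e' [s [ev zE s01]]]].
- have tb : ((1 / 2 < t)%R : nat)%:R = t.
    case: t01 => ->; last by have -> : (1 / 2 < 1 :> R) by lra.
    by have -> : (1 / 2 < 0 :> R) = false by apply/negbTE; rewrite -leNgt; lra.
  rewrite /ray /base /dir /ht yv /= mulr0 addr0 tb.
  by split=> //; case: t01 => ->; lra.
- rewrite /ray /base /dir /ht zE /=.
  have -> : (1 / 2 < s) = false by apply/negbTE; rewrite -leNgt; lra.
  have -> : Num.min s (1 - s) = s by apply/min_idPl; lra.
  rewrite /= expr0 mul1r add0r; split; [lra|lra| |lra|].
    by apply: vertex_eq; rewrite edge_mpoint0 ev.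
  by apply: point_inj; rewrite zE /= edge_mpoint_interior//; lra.
- rewrite /ray /base /dir /ht zE /=.
  have -> : 1 / 2 < s by lra.
  have -> : Num.min s (1 - s) = 1 - s by apply/min_idPr; lra.
  have -> : 1 + (-1) ^+ true * (1 - s) = s by rewrite expr1; lra.
  split; [lra|by rewrite /= ler01 lexx| |lra|].
    by apply: vertex_eq; rewrite edge_mpoint1 ev.
  by apply: point_inj; rewrite zE /= edge_mpoint_interior//; lra.
apply: mdist_ge => [a b ha hb|e' s s' zE zE'].
  (* A route through vertices costs at least the sum of the heights, which also dominates their
     difference. *)
  apply: anchor_sum_le; first exact: ltr01.
  have := ht_anchor z _ ha; have := ht_anchor z' _ hb.
  have := ht_ge0 z; have := ht_ge0 z'; move: (a.2) (b.2) => u w.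
  by case: ifP => _ *; rewrite ?ler_norml; lra.
have := ht_le _ yz; have := ht_le _ yz'; have := svalP z; have := svalP z'.
rewrite lee_fin /ht /dir zE zE' xpair_eqE eqxx /= mulr1 => /andP[s0' s1'] /andP[s0 s1].
rewrite /Num.min.
case: (ltP s (1 - s)) => hs; case: (ltP s' (1 - s')) => hs';
case: (ltP (1 / 2) s) => ks; case: (ltP (1 / 2) s') => ks' /=; try lra.
- by have := ler_norm (s' - s); rewrite distrC; lra.
- by have := ler_norm (s - s'); lra.
- by move=> _ _; rewrite (_ : 1 - s - (1 - s') = s' - s) 1?distrC//; lra.
Qed.

Lemma star_chart_exists (e : gE G) (t : R) : 0 <= t <= 1 ->
  exists rho dir base ht, 0 < rho /\ star_chart (edge_point e t) rho dir base ht.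
Proof.
by move=> /edge_mpointP[tE|tE|]; [apply: star_chart_vertex; left
  |apply: star_chart_vertex; right|apply: star_chart_interior].
Qed.

End StarChart.

(** The supremum of the points reachable from [a] is reachable by the local hypothesis on its left,
    and the hypothesis on its right goes beyond it unless it is [b]. Only pairs having [t] as an
    endpoint are required locally, since radial isometries and star charts are tied to a centre. *)
Lemma interval_chain_ind (R : realType) (P : R -> R -> Prop) (a b : R) : a <= b ->
  (forall x y z, a <= x <= y -> y <= z <= b -> P x y -> P y z -> P x z) ->
  (forall t, a <= t <= b -> exists2 delta, 0 < delta &
     forall s, a <= s <= b -> `|s - t| < delta ->
       (t <= s -> P t s) /\ (s <= t -> P s t)) ->
  P a b.
Proof.
move=> ab Ptrans Ploc.
pose S := [set x | a <= x <= b /\ P a x].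
have Sa : S a.
  split; first by rewrite lexx.
  have [|d d0 h] := Ploc a; first by rewrite lexx.
  by have [||+ _] := h a; rewrite ?lexx ?subrr ?normr0//; apply.
have Sb : ubound S b by move=> x [/andP[]].
have supS : has_sup S by split; [exists a|exists b].
have ac : a <= sup S by apply: ub_le_sup => //; exists b.
have cb : sup S <= b by apply: ge_sup => //; exists a.
have [d d0 Pd] := Ploc (sup S) (introT andP (conj ac cb)).
have [x [/andP[ax xb] Pax] xc] := sup_adherent d0 supS.
have xc' : x <= sup S.
  by apply: ub_le_sup; [exists b|split=> //; apply/andP].
have Pac : P a (sup S).
  have [||_ /(_ xc') Pxc] := Pd x; rewrite ?ax ?xb//.
    by rewrite distrC ger0_norm ?subr_ge0//; lra.
  apply: Ptrans Pax Pxc; rewrite ?lexx ?ax//.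
  by rewrite xc' cb.
pose s := Num.min b (sup S + d / 2).
have sE : s = b \/ s = sup S + d / 2.
  by rewrite /s /Num.min; case: ifP; [left|right].
have sc : sup S <= s by rewrite le_min cb; lra.
have sb : s <= b by rewrite ge_min lexx.
have ds : s <= sup S + d / 2 by rewrite ge_min lexx orbT.
have Pas : P a s.
  have [||/(_ sc) Pcs _] := Pd s; rewrite ?sb ?andbT//.
  - lra.
  - by rewrite ger0_norm ?subr_ge0//; lra.
  by apply: Ptrans Pac Pcs; rewrite ?ac ?lexx ?sc ?sb.
case: sE => [<-//|sE].
have : s <= sup S by apply: ub_le_sup; [exists b|split=> //; rewrite sb; lra].
by rewrite sE; lra.
Qed.

(** * Arc length and maps that preserve it *)

Section ArcLength.
Variables (R : realType).

(** A recursive form of the sum in [arclen], suited to concatenating subdivisions. *)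
Fixpoint chain_sum (d : R -> R -> \bar R) (a : R) (r : seq R) : \bar R :=
  if r is b :: r' then (d a b + chain_sum d b r')%E else 0%E.

Lemma sum_chain_sum d a r :
  (\sum_(i < size r) d (nth 0%R (a :: r) i) (nth 0%R r i))%E = chain_sum d a r.
Proof.
elim: r a => [|b r ih] a; first by rewrite big_ord0.
by rewrite big_ord_recl /= -ih; congr (_ + _)%E; apply: eq_bigr => i _.
Qed.

Lemma chain_sum_cat d a r s :
  chain_sum d a (r ++ s) = (chain_sum d a r + chain_sum d (last a r) s)%E.
Proof. by elim: r a => [|b r ih] a /=; rewrite ?add0e// ih addeA. Qed.

Lemma le_chain_sum_last (d : R -> R -> \bar R) a r :
  (forall x, d x x = 0%E) ->
  (forall x y z, d x z <= d x y + d y z)%E -> (d a (last a r) <= chain_sum d a r)%E.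
Proof.
move=> d0 dtri; elim: r a => [|b r ih] a /=; first by rewrite d0.
by apply: le_trans (dtri a b _) _; rewrite leeD2l.
Qed.

Lemma path_lt_bounds (a : R) r x : path <%R a r -> x \in a :: r -> a <= x <= last a r.
Proof.
elim: r a x => [|b r ih] a x /=; first by rewrite inE => _ /eqP->; rewrite lexx.
move=> /andP[ab pr].
have /andP[_ bl] := ih b b pr (mem_head _ _).
rewrite inE => /predU1P[->|/(ih _ _ pr)/andP[bx ->]]; last by rewrite andbT; lra.
by rewrite lexx; lra.
Qed.

(* Two distances agreeing along some subdivision of every interval have the
   same sums along common refinements, hence the same suprema. *)
Lemma chain_sum_refine (d d' : R -> R -> \bar R) (a : R) r :
  (forall x, d x x = 0%E) -> (forall x y, 0%E <= d x y)%E ->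
  (forall x y, 0%E <= d' x y)%E ->
  (forall x y z, d x z <= d x y + d y z)%E ->
  (forall x y, a <= x <= y -> y <= last a r -> exists s,
     [/\ path <%R x s, last x s = y & chain_sum d x s = chain_sum d' x s]) ->
  path <%R a r ->
  exists s, [/\ path <%R a s, last a s = last a r,
    (chain_sum d a r <= chain_sum d a s)%E & chain_sum d a s = chain_sum d' a s].
Proof.
move=> d0 dge0 d'ge0 dtri; elim: r a => [|b r ih] a /= agree; first by exists [::].
move=> /andP[ab pr].
have br : b <= last b r by have /andP[] := path_lt_bounds pr (mem_head _ _).
have [||s1 [ps1 ls1 e1]] := agree a b; rewrite ?lexx ?(ltW ab)//.
have [x y /andP[bx xy] yr||s2 [ps2 ls2 le2 e2]] := ih b; last 1 first.
- exists (s1 ++ s2); rewrite cat_path last_cat ls1 ps1 ps2 ls2; split=> //.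
    rewrite chain_sum_cat// ls1 leeD// -ls1; exact: le_chain_sum_last.
  by rewrite !chain_sum_cat// ls1 e1 e2.
- by apply: agree => //; rewrite xy (le_trans (ltW ab) bx).
- by [].
Qed.

Variables (G : fin_mgraph) (L : R).

Definition path_dist (p : R -> point R G) (s t : R) : \bar R := pdist L (p s) (p t).

Lemma chain_sum_le_arclen p r : path <%R 0 r -> last 0 r = 1 ->
  (chain_sum (path_dist p) 0 r <= arclen L p)%E.
Proof.
move=> pr lr; apply: ereal_sup_ubound; exists r; split=> //.
by rewrite -sum_chain_sum.
Qed.

Lemma arclen_le p c :
  (forall r, path <%R 0 r -> last 0 r = 1 -> (chain_sum (path_dist p) 0 r <= c)%E) ->
  (arclen L p <= c)%E.
Proof.
move=> h; apply: ge_ereal_sup => _ [r [pr lr ->]].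
by rewrite (sum_chain_sum (path_dist p)) h.
Qed.

End ArcLength.

(* Distances from one centre only need to be preserved near that centre:
   a fold is allowed at every point. *)
Definition radial_isometry (R : realType) (X Y : fin_mgraph) (LX LY : R)
    (m : point R X -> point R Y) : Prop :=
  forall x, exists2 eps : R, 0 < eps &
    forall z, (pdist LX z x < eps%:E)%E -> pdist LY (m z) (m x) = pdist LX z x.

(** By continuity [p] stays near [p t] for times near [t], where distances to [p t] are kept. Hence
    every interval has a subdivision on which both sums agree, and refining in both directions
    compares the suprema, finite or not. *)
Lemma radial_isometry_arclen (R : realType) (X Y : fin_mgraph) (LX LY : R)
    (m : point R X -> point R Y) (p : R -> point R X) :
  0 < LX -> 0 < LY -> radial_isometry LX LY m -> is_path LX p ->
  arclen LX p = arclen LY (m \o p).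
Proof.
move=> LX0 LY0 rm pp.
pose d := path_dist LX p; pose d' := path_dist LY (m \o p).
have d0 x : d x x = 0%E by exact: pdist_xx.
have d'0 x : d' x x = 0%E by exact: pdist_xx.
have dge0 x y : (0 <= d x y)%E by exact: pdist_ge0.
have d'ge0 x y : (0 <= d' x y)%E by exact: pdist_ge0.
have dtri x y z : (d x z <= d x y + d y z)%E by exact: pdist_triangle.
have d'tri x y z : (d' x z <= d' x y + d' y z)%E by exact: pdist_triangle.
have agree x y : 0 <= x <= y -> y <= 1 -> exists s,
    [/\ path <%R x s, last x s = y & chain_sum d x s = chain_sum d' x s].
  move=> /andP[x0 xy] y1.
  pose P u v := exists s,
    [/\ path <%R u s, last u s = v & chain_sum d u s = chain_sum d' u s].
  apply: (@interval_chain_ind R P) => //.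
    move=> u v w _ _ [s [ps ls es]] [s' [ps' ls' es']]; exists (s ++ s').
    by rewrite cat_path last_cat ls ps ps' ls' !chain_sum_cat// ls es es'.
  move=> t /andP[xt ty]; have [eps eps0 me] := rm (p t).
  have t01 : 0 <= t <= 1 by lra.
  have [delta [delta0 pd]] := pp t t01 eps eps0.
  exists delta => // s /andP[xs sy] st.
  have E : d s t = d' s t by rewrite /d' /path_dist /= me// pd//; lra.
  have E' : d t s = d' t s.
    by rewrite /d /d' /path_dist pdist_sym// [RHS]pdist_sym.
  split; rewrite le_eqVlt => /predU1P[->|ts]; try by exists [::].
    by exists [:: s]; rewrite /= ts E'.
  by exists [:: t]; rewrite /= ts E.
apply/le_anti/andP; split; apply: arclen_le => r pr lr.
  have [|s [ps ls rs es]] := chain_sum_refine d0 dge0 d'ge0 dtri _ pr.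
    by rewrite lr.
  by rewrite (le_trans rs)// es chain_sum_le_arclen// ls lr.
have [|s [ps ls rs es]] := chain_sum_refine d'0 d'ge0 dge0 d'tri _ pr.
  by rewrite lr => x y xy y1; have [s [ps ls es]] := agree x y xy y1; exists s.
by rewrite (le_trans rs)// es chain_sum_le_arclen// ls lr.
Qed.

(** * Chains of straight segments and their unit-speed curves *)

Section Chains.
Variables (R : realType) (G : fin_mgraph).
Implicit Types y z : point R G.

(* An edge with an initial and a final coordinate. *)
Definition seg : Type := (gE G * (R * R))%type.
Implicit Types l : seq seg.

Definition seg_ok (s : seg) : bool := (0 <= s.2.1 <= 1) && (0 <= s.2.2 <= 1).

Fixpoint is_chain y l y' : Prop :=
  if l is s :: l'
  then [/\ seg_ok s, edge_point s.1 s.2.1 = y & is_chain (edge_point s.1 s.2.2) l' y']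
  else y = y'.

Definition chain_len l : R := \sum_(s <- l) `|s.2.2 - s.2.1|.

Definition between (a b t : R) : bool := (a <= t <= b) || (b <= t <= a).

Definition covers l z : Prop :=
  exists s t, [/\ s \in l, between s.2.1 s.2.2 t & z = edge_point s.1 t].

Definition rev_chain l : seq seg := rev [seq (s.1, (s.2.2, s.2.1)) | s <- l].

Lemma between_sym a b t : between a b t = between b a t.
Proof. exact: orbC. Qed.

Lemma is_chain_cat y l y' l' y'' :
  is_chain y l y' -> is_chain y' l' y'' -> is_chain y (l ++ l') y''.
Proof.
by elim: l y => [|s l ih] y /= => [->//|[ok sy c] c']; split=> //; exact: ih.
Qed.

Lemma chain_len_cat l l' : chain_len (l ++ l') = chain_len l + chain_len l'.
Proof. exact: big_cat. Qed.

Lemma chain_len_ge0 l : 0 <= chain_len l.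
Proof. by apply: sumr_ge0. Qed.

Lemma covers_cat l l' z : covers (l ++ l') z <-> covers l z \/ covers l' z.
Proof.
split=> [[s [t [+ st zE]]]|[] [s [t [sl st zE]]]].
- by rewrite mem_cat => /orP[sl|sl]; [left|right]; exists s, t.
- by exists s, t; rewrite mem_cat sl.
- by exists s, t; rewrite mem_cat sl orbT.
Qed.

Lemma is_chain_rev y l y' : is_chain y l y' -> is_chain y' (rev_chain l) y.
Proof.
elim: l y => [|s l ih] y /=; first by move=> ->.
move=> [ok sy /ih c]; rewrite /rev_chain /= rev_cons -cats1.
by apply: is_chain_cat c _; split; rewrite //= /seg_ok andbC.
Qed.

Lemma chain_len_rev l : chain_len (rev_chain l) = chain_len l.
Proof.
rewrite /chain_len /rev_chain (perm_big _ (permEl (perm_rev _))) big_map.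
by apply: eq_bigr => s _; rewrite distrC.
Qed.

Lemma covers_rev l z : covers l z -> covers (rev_chain l) z.
Proof.
move=> [s [t [sl st zE]]]; exists (s.1, (s.2.2, s.2.1)), t; split=> //=.
  by rewrite mem_rev; apply/mapP; exists s.
by rewrite between_sym.
Qed.

Lemma is_chain_ok y l y' s : is_chain y l y' -> s \in l -> seg_ok s.
Proof.
elim: l y => // s' l ih y /= [ok _ c]; rewrite inE => /predU1P[->//|]; exact: ih c.
Qed.

(** The missing length is spent at the start, going back and forth on the edge of the first segment;
    this is why the chain must be nonempty. *)
Lemma chain_pad y l y' (A : R) : l != [::] -> is_chain y l y' -> chain_len l <= A ->
  exists l', [/\ is_chain y l' y', chain_len l' = A & forall z, covers l z -> covers l' z].
Proof.
case: l => // -[g [t t']] l _ cl lA; have [ok gy _] := cl.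
pose E := A - chain_len ((g, (t, t')) :: l).
have E0 : 0 <= E by rewrite subr_ge0.
(* [n] round trips of length [2 * d] make up [E]. As [n] is at least [E], [d] is at most [1 / 2], so
   the edge has room for a move of length [d] towards its farther end. *)
pose n := (Num.bound E).+1.
have nE : E <= n%:R.
  by have := archi_boundP E0; rewrite /n -natr1; lra.
have n0 : (n%:R : R) != 0 by rewrite pnatr_eq0.
pose d := E / (2 * n%:R).
have d0 : 0 <= d by rewrite divr_ge0// mulr_ge0.
have d1 : d <= 1 / 2.
  rewrite /d ler_pdivrMr ?mulr_gt0 ?ltr0n//; lra.
have t01 : 0 <= t <= 1 by move: ok => /andP[].
pose u := if t <= 1 / 2 then t + d else t - d.
have u01 : 0 <= u <= 1 by rewrite /u; case: ifPn; [|rewrite -ltNge]; lra.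
have ud : `|u - t| = d.
  rewrite /u; case: ifP => _; first by rewrite (_ : _ - t = d) ?ger0_norm//; lra.
  by rewrite (_ : _ - t = - d) ?normrN ?ger0_norm//; lra.
pose wiggle k : seq seg := iter k (cat [:: (g, (t, u)); (g, (u, t))]) [::].
have wc k : is_chain y (wiggle k) y.
  by elim: k => //= k ih; rewrite /seg_ok /= t01 u01 gy.
have wl k : chain_len (wiggle k) = k%:R * (2 * d).
  elim: k => [|k ih]; first by rewrite /chain_len big_nil mul0r.
  rewrite /= -[_ :: _ :: _]/([:: (g, (t, u)); (g, (u, t))] ++ wiggle k).
  rewrite chain_len_cat ih /chain_len !big_cons big_nil /= (distrC t) ud -natr1; lra.
exists (wiggle n ++ (g, (t, t')) :: l); split.
- exact: is_chain_cat (wc n) cl.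
- rewrite chain_len_cat wl /d (_ : _ * _ = E); first by rewrite /E subrK.
  by field.
- by move=> z hz; apply/covers_cat; right.
Qed.

Definition unit_speed (A : R) (c : R -> point R G) : Prop :=
  forall s, 0 <= s <= A -> exists2 eps, 0 < eps &
    forall s', 0 <= s' <= A -> `|s' - s| < eps -> pdist 1 (c s') (c s) = `|s' - s|%:E.

(** At the junction the points of either side are compared with the junction only, never with each
    other, so the second curve may even retrace the first. *)
Lemma unit_speed_cat A B c c' : 0 <= A -> 0 <= B ->
  unit_speed A c -> unit_speed B c' -> c A = c' 0 ->
  unit_speed (A + B) (fun s => if s <= A then c s else c' (s - A)).
Proof.
move=> A0 B0 uc uc' cc' s /andP[s0 sAB].
have [sA|sA|sA] := ltgtP s A.
- have [|r r0 hr] := uc s; first by rewrite s0 ltW.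
  exists (Num.min r (A - s)); first by rewrite lt_min r0 subr_gt0.
  move=> s' /andP[s'0 _]; rewrite lt_min => /andP[s'r s'A].
  have s'A' : s' <= A by move: s'A; rewrite ltr_norml; lra.
  by rewrite s'A' hr ?s'0.
- have [|r r0 hr] := uc' (s - A); first lra.
  exists (Num.min r (s - A)); first by rewrite lt_min r0 subr_gt0.
  move=> s' /andP[s'0 s'AB]; rewrite lt_min => /andP[s'r s'A].
  have s'A' : A < s' by move: s'A; rewrite ltr_norml; lra.
  rewrite leNgt s'A' /=; have E : s' - A - (s - A) = s' - s by lra.
  by rewrite -E hr ?E//; lra.
- subst s; have [|r r0 hr] := uc A; first by rewrite A0 lexx.
  have [|r' r'0 hr'] := uc' 0; first by rewrite lexx.
  exists (Num.min r r'); first by rewrite lt_min r0.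
  move=> s' /andP[s'0 s'AB]; rewrite lt_min => /andP[s'r s'r'].
  case: leP => s'A; first by rewrite hr ?s'0.
  by rewrite cc' hr' ?subr0//; lra.
Qed.

Lemma seg_curve (s : seg) : seg_ok s -> exists c,
  [/\ unit_speed `|s.2.2 - s.2.1| c, c 0 = edge_point s.1 s.2.1,
      c `|s.2.2 - s.2.1| = edge_point s.1 s.2.2 &
      forall t, between s.2.1 s.2.2 t ->
        exists2 u, 0 <= u <= `|s.2.2 - s.2.1| & c u = edge_point s.1 t].
Proof.
case: s => g [a b]; rewrite /seg_ok /= => /andP[a01 b01].
have half : 0 < 1 / 2 :> R by lra.
have [ab|ab] := leP a b.
  exists (fun u => edge_point g (a + u)); split.
  - move=> u; rewrite ger0_norm ?subr_ge0// => u0; exists (1 / 2) => // u' u'0 uu.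
    have E : a + u' - (a + u) = u' - u by lra.
    by rewrite edge_point_dist ?E ?mulr1 ?(ltW uu)//; lra.
  - by rewrite addr0.
  - by rewrite ger0_norm ?subr_ge0// addrC subrK.
  - move=> t /orP tab; exists (t - a); last by rewrite addrC subrK.
    by rewrite ger0_norm ?subr_ge0//; case: tab; lra.
exists (fun u => edge_point g (a - u)); split.
- move=> u; rewrite ltr0_norm ?subr_lt0// => u0; exists (1 / 2) => // u' u'0 uu.
  have E : a - u' - (a - u) = - (u' - u) by lra.
  by rewrite edge_point_dist ?E ?normrN ?mulr1 ?(ltW uu)//; lra.
- by rewrite subr0.
- by rewrite ltr0_norm ?subr_lt0// opprB opprB addrC subrK.
- move=> t /orP tab; exists (a - t); last by rewrite opprB addrC subrK.
  by rewrite ltr0_norm ?subr_lt0//; case: tab; lra.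
Qed.

Lemma chain_curve y l y' : is_chain y l y' -> exists c,
  [/\ unit_speed (chain_len l) c, c 0 = y, c (chain_len l) = y' &
      forall z, covers l z -> exists2 u, 0 <= u <= chain_len l & c u = z].
Proof.
elim: l y => [|s l ih] y /=.
  move=> <-; exists (fun=> y); split=> // [u|z [s [t []//]]].
  rewrite /chain_len big_nil => u0; exists 1 => // u' u'0 _.
  have -> : u' = 0 by lra.
  have -> : u = 0 by lra.
  by rewrite subrr normr0 pdist_xx.
move=> [ok sy /ih[c' [uc' c'0 c'1 cov']]].
have [c [uc c0 c1 cov]] := seg_curve ok.
set A := `|s.2.2 - s.2.1| in uc c1 cov.
have A0 : 0 <= A by exact: normr_ge0.
have B0 := chain_len_ge0 l.
have -> : chain_len (s :: l) = A + chain_len l by rewrite /chain_len big_cons.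
have cc' : c A = c' 0 by rewrite c1 c'0.
exists (fun u => if u <= A then c u else c' (u - A)); split.
- exact: unit_speed_cat.
- by rewrite A0 c0.
- rewrite gerDl; case: leP => [l0|_]; last by rewrite addrAC subrr add0r.
  have E : chain_len l = 0 by apply/le_anti; rewrite l0.
  by rewrite E addr0 cc' -c'1 E.
- move=> z [s' [t [+ st ->]]]; rewrite inE => /predU1P[sE|sl].
    rewrite sE in st *; have [u /andP[u0 uA] cu] := cov t st.
    by exists u; rewrite ?uA// u0 (le_trans uA)// lerDl.
  have [|u /andP[u0 ul] cu] := cov' (edge_point s'.1 t); first by exists s', t.
  exists (u + A); first lra.
  have [uE|un] := eqVneq u 0; first by rewrite -cu uE add0r lexx cc'.
  by rewrite leNgt ltrDr lt0r un u0 /= addrK.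
Qed.

End Chains.

(** * Foldings built from chains *)

Lemma pos_lower_bound (R : realType) (T : eqType) (s : seq T) (r : T -> R) :
  (forall x, x \in s -> 0 < r x) -> exists2 eps, 0 < eps & forall x, x \in s -> eps <= r x.
Proof.
elim: s => [|x s ih] rs; first by exists 1.
have [|eps eps0 h] := ih; first by move=> z zs; rewrite rs// inE zs orbT.
exists (Num.min eps (r x)); first by rewrite lt_min eps0 rs ?mem_head.
by move=> z; rewrite inE ge_min => /predU1P[->|/h->//]; rewrite lexx orbT.
Qed.

Lemma foldable_of_chains (R : realType) (X Y : fin_mgraph) (alpha : R)
    (f : gV X -> point R Y) (l : gE X -> seq (seg R Y)) :
  0 < alpha ->
  (forall e, is_chain (f (gends e).1) (l e) (f (gends e).2)) ->
  (forall e, l e != [::]) -> (forall e, chain_len (l e) <= alpha) ->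
  (forall z, (exists v, f v = z) \/ exists e, covers (l e) z) ->
  foldable_scale X Y alpha.
Proof.
move=> alpha0 lc ln ll cov; split=> //.
have /choice[c cP] e : exists c, [/\ unit_speed alpha c, c 0 = f (gends e).1,
    c alpha = f (gends e).2 &
    forall z, covers (l e) z -> exists2 u, 0 <= u <= alpha & c u = z].
  have [l' [cl' <- cov']] := chain_pad (ln e) (lc e) (ll e).
  have [c [uc c0 c1 covc]] := chain_curve cl'.
  by exists c; split=> // z /cov'; exact: covc.
pose m (x : point R X) : point R Y :=
  match sval x with MV v => f v | ME e t => c e (t * alpha) end.
have mE e t : 0 <= t <= 1 -> m (edge_point e t) = c e (t * alpha).
  have [_ c0 c1 _] := cP e.
  move=> /edge_mpointP[->|->|t01]; rewrite /m /= ?edge_mpoint0 ?edge_mpoint1.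
  - by rewrite mul0r.
  - by rewrite mul1r.
  - by rewrite edge_mpoint_interior.
have scale t : 0 <= t <= 1 -> 0 <= t * alpha <= alpha.
  by move=> /andP[t0 t1]; rewrite mulr_ge0 ?(ltW alpha0)// ler_piMl// ltW.
exists m; split.
  move=> z; case: (cov z) => [[v <-]|[e ce]].
    by exists (exist (fun x : mpoint R X => mvalid x) (MV R v) isT).
  have [_ _ _ /(_ _ ce)[u /andP[u0 u1] cu]] := cP e.
  exists (edge_point e (u / alpha)).
  rewrite mE ?divfK ?gt_eqF//.
  by rewrite divr_ge0 ?(ltW alpha0)// ler_pdivrMr// mul1r.
move=> p; apply: radial_isometry_arclen => // {p} x.
have near_dist e s t : 0 <= s <= 1 -> 0 <= t <= 1 -> `|s - t| <= 1 / 2 ->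
    pdist alpha (edge_point e s) (edge_point e t) = `|s * alpha - t * alpha|%:E.
  by move=> s01 t01 st; rewrite edge_point_dist// -mulrBl normrM (gtr0_norm alpha0).
case xE : (sval x) => [v|e t].
  (* A loop meets the vertex with both ends, so the radius has to serve both ends of every edge. *)
  have /choice[r rP] e : exists r, [/\ 0 < r,
      forall u, 0 <= u <= alpha -> u < r -> pdist 1 (c e u) (c e 0) = u%:E &
      forall u, 0 <= u <= alpha -> alpha - u < r ->
        pdist 1 (c e u) (c e alpha) = (alpha - u)%:E].
    have [uc _ _ _] := cP e.
    have [|r r0 hr] := uc 0; first by rewrite lexx ltW.
    have [|r' r'0 hr'] := uc alpha; first by rewrite lexx ltW.
    exists (Num.min r r'); split; first by rewrite lt_min r0.
      move=> u /[dup] u01 /andP[u0 _]; rewrite lt_min => /andP[ur _].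
      by have := hr _ u01; rewrite subr0 ger0_norm//; apply.
    move=> u /[dup] u01 /andP[_ u1]; rewrite lt_min => /andP[_ ur].
    by have := hr' _ u01; rewrite distrC ger0_norm ?subr_ge0//; apply.
  have [|eps eps0 epsr] := @pos_lower_bound R _ (enum (gE X)) r.
    by move=> e _; have [] := rP e.
  (* Below [alpha / 2] a point lies on the half of its edge next to the vertex, where
     [edge_point_dist] is exact. *)
  exists (Num.min eps (alpha / 2)); first by rewrite lt_min eps0; lra.
  move=> z; rewrite pdist_sym// => xz.
  have mx : Num.min eps (alpha / 2) <= eps by rewrite ge_min lexx.
  have ma : Num.min eps (alpha / 2) <= alpha / 2 by rewrite ge_min lexx orbT.
  have [|->|[e [t [ev zE tr]]]|[e [t [ev zE tr]]]] := near_vertex alpha0 xE _ xz.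
  - lra.
  - by rewrite !pdist_xx.
  - have [t01 ->] := sval_ME zE.
    have xE0 : x = edge_point e 0 by apply: point_inj; rewrite xE /= edge_mpoint0 ev.
    have er := epsr e (mem_enum _ e).
    have [_ h _] := rP e.
    have ta : 0 <= t * alpha <= alpha by apply: scale; lra.
    have t2 : t <= 1 / 2 by rewrite -(ler_pM2r alpha0); lra.
    rewrite xE0 (near_dist _ e 0 t); [|lra|lra|by rewrite distrC subr0 ger0_norm; lra].
    rewrite !mE; [|lra|lra]; rewrite mul0r distrC subr0 ger0_norm; last by case/andP: ta.
    by apply: h => //; lra.
  - have [t01 ->] := sval_ME zE.
    have xE1 : x = edge_point e 1 by apply: point_inj; rewrite xE /= edge_mpoint1 ev.
    have er := epsr e (mem_enum _ e).
    have [_ _ h] := rP e.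
    have ta : 0 <= t * alpha <= alpha by apply: scale; lra.
    have t2 : 1 - t <= 1 / 2 by rewrite -(ler_pM2r alpha0); lra.
    rewrite xE1 (near_dist _ e 1 t); [|lra|lra|by rewrite ger0_norm; lra].
    rewrite !mE; [|lra|lra]; rewrite mul1r ger0_norm ?subr_ge0; last by case/andP: ta.
    by apply: h => //; lra.
have [t01 xEt] := sval_ME xE.
have ta : 0 <= t * alpha <= alpha by apply: scale; lra.
have [uc _ _ _] := cP e.
have [r r0 hr] := uc _ ta.
have m0 : 0 < Num.min t (1 - t) by rewrite lt_min; lra.
have m1 : Num.min t (1 - t) <= t by rewrite ge_min lexx.
have m2 : Num.min t (1 - t) <= 1 - t by rewrite ge_min lexx orbT.
exists (Num.min r (Num.min t (1 - t) / 2 * alpha)).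
  by rewrite lt_min r0 mulr_gt0//; lra.
move=> z; rewrite pdist_sym// xEt => xz.
have [|s [s01 st zE]] := @near_interior R X alpha alpha0 e t z t01.
  by apply: lt_le_trans xz _; rewrite lee_fin ge_min lexx orbT.
have [_ zEs] := sval_ME zE; move: xz.
have sa : 0 <= s * alpha <= alpha by apply: scale; lra.
have E : pdist alpha (edge_point e t) (edge_point e s) = `|s * alpha - t * alpha|%:E.
  by rewrite near_dist ?[RHS]distrC//; [rewrite distrC|lra|lra|rewrite distrC; lra].
rewrite zEs E lte_fin lt_min => /andP[sr _].
rewrite !mE; [|lra|lra]; rewrite hr//.
Qed.

(** * Replacing a Lipschitz curve by a finite chain *)

Lemma lipschitz_max (R : realType) (f : R -> R) (K b : R) : 0 <= b -> 0 < K ->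
  (forall s t, 0 <= s <= b -> 0 <= t <= b -> `|f s - f t| <= K * `|s - t|) ->
  exists2 c, 0 <= c <= b & forall t, 0 <= t <= b -> f t <= f c.
Proof.
move=> b0 K0 fK.
(* Composition with this 1-Lipschitz retraction onto [[0, b]] extends [f] continuously to the whole
   line. *)
pose clamp (s : R) := Num.max 0 (Num.min b s).
have clamp_in s : 0 <= clamp s <= b.
  by rewrite le_max lexx ge_max b0 ge_min lexx.
have clamp_id s : 0 <= s <= b -> clamp s = s.
  by move=> /andP[s0 sb]; rewrite /clamp (min_idPr sb) (max_idPr s0).
have clamp_lip s t : `|clamp s - clamp t| <= `|s - t|.
  wlog st : s t / s <= t => [hw|].
    by have [/hw//|/ltW/hw] := leP s t; rewrite distrC [leRHS]distrC.
  rewrite distrC [leRHS]distrC [leRHS]ger0_norm ?subr_ge0//.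
  rewrite /clamp /Num.max /Num.min.
  case: (ltP b s) => ?; case: (ltP b t) => ?; case: (ltP 0 s) => ?;
    case: (ltP 0 t) => ?; case: (ltP 0 b) => ?; rewrite ler_norml; lra.
have cf : continuous (f \o clamp).
  move=> t; apply/cvgrPdist_lt => e e0; have eK : 0 < e / K by rewrite divr_gt0.
  apply/nbhs_ballP; exists (e / K) => // s ts.
  apply: le_lt_trans (fK _ _ (clamp_in _) (clamp_in _)) _.
  by rewrite -ltr_pdivlMl// mulrC; apply: le_lt_trans (clamp_lip _ _) ts.
have [c] := EVT_max b0 (continuous_subspaceT cf).
rewrite in_itv /= => c01 cm; exists c => // t t01.
by have := cm t; rewrite in_itv /= => /(_ t01); rewrite !clamp_id.
Qed.

Section CurveChain.
Variables (R : realType) (G : fin_mgraph).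
Implicit Types y z : point R G.

Section Chart.
Variables (y : point R G) (rho : R) (dir : point R G -> gE G * bool)
  (base : gE G * bool -> R) (ht : point R G -> R).
Hypothesis chart : star_chart y rho dir base ht.

(** The whole radius from the centre to [z] is required, so that reaching the highest point of a ray
    takes care of all lower ones. *)
Definition covers_ray (l : seq (seg R G)) z : Prop :=
  forall s, 0 <= s <= ht z -> covers l (edge_point (dir z).1 (ray base (dir z) s)).

Lemma between_ray h (a b s : R) : a <= s <= b ->
  between (ray base h a) (ray base h b) (ray base h s).
Proof.
rewrite /between /ray; case: h.2; rewrite ?expr1 ?expr0 => /andP[sa sb]; apply/orP.
  by right; apply/andP; split; lra.
by left; apply/andP; split; lra.
Qed.

Lemma ray0 h : ray base h 0 = base h.
Proof. by rewrite /ray mulr0 addr0. Qed.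

Lemma ray_dist h a b : `|ray base h a - ray base h b| = `|a - b|.
Proof.
by rewrite /ray opprD addrACA subrr add0r -mulrBr normrM normrX normrN1 expr1n mul1r.
Qed.

(** In a star the shortest move stays on the common ray or passes through the centre, and the chart
    bounds its length by the distance. On a common ray the part below [z] is already covered by
    [l0]; a move through the centre covers the new radius by itself. *)
Lemma star_step l0 z z' (d : R) :
  (pdist 1 y z < rho%:E)%E -> (pdist 1 y z' < rho%:E)%E -> (pdist 1 z z' <= d%:E)%E ->
  covers_ray l0 z ->
  exists l, [/\ is_chain z l z', chain_len l <= d & covers_ray (l0 ++ l) z'].
Proof.
have [rays [pairs _]] := chart.
move=> yz yz' zz' cz.
have := le_trans (pairs _ _ yz yz') zz'; rewrite lee_fin.
have [hz bz bzE rz rzE] := rays _ yz; have [hz' bz' bzE' rz' rzE'] := rays _ yz'.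
case: eqVneq => [dE|dN] hd.
  exists [:: ((dir z).1, (ray base (dir z) (ht z), ray base (dir z) (ht z')))]; split.
  - by split; rewrite //= /seg_ok ?rz ?dE ?rz'.
  - by rewrite /chain_len big_seq1 /= ray_dist distrC.
  - move=> s /andP[s0 sz]; apply/covers_cat.
    have [sz'|sz'] := leP s (ht z); first by left; rewrite -dE; apply: cz; rewrite s0.
    right; eexists; exists (ray base (dir z') s); split; first exact: mem_head.
      by rewrite /= dE; apply: between_ray; rewrite ltW.
    by rewrite dE.
exists [:: ((dir z).1, (ray base (dir z) (ht z), base (dir z)));
           ((dir z').1, (base (dir z'), ray base (dir z') (ht z')))]; split.
- by split; rewrite //= /seg_ok /= ?rz ?bz//; split; rewrite /= ?bz' ?rz' ?bzE ?bzE'.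
- rewrite /chain_len !big_cons big_nil addr0 /= -!ray0 !ray_dist subr0 sub0r normrN.
  by rewrite !ger0_norm.
- move=> s /andP[s0 sz]; apply/covers_cat; right.
  exists ((dir z').1, (base (dir z'), ray base (dir z') (ht z'))), (ray base (dir z') s).
  split; first by rewrite !inE eqxx orbT.
    by rewrite /= -ray0; apply: between_ray; rewrite s0.
  by [].
Qed.

Variables (c : R -> point R G) (K b : R).
Hypotheses (K0 : 0 < K) (b0 : 0 <= b) (Kb : K * b < rho) (c0 : c 0 = y).
Hypothesis cK : forall s t, 0 <= s <= b -> 0 <= t <= b ->
  (pdist 1 (c s) (c t) <= (K * `|s - t|)%:E)%E.

Let c_near s : 0 <= s <= b -> (pdist 1 y (c s) < rho%:E)%E.
Proof.
move=> s01; rewrite -c0; apply: le_lt_trans (cK _ s01) _; first by rewrite lexx.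
rewrite lte_fin; apply: le_lt_trans Kb; rewrite ler_pM2l// sub0r normrN.
by rewrite ger0_norm; lra.
Qed.

Lemma sorted_times_chain (S : seq R) : path <=%R 0 S -> last 0 S <= b ->
  exists l, [/\ is_chain y l (c (last 0 S)), l != [::], chain_len l <= K * last 0 S &
    forall t, t \in 0 :: S -> covers_ray l (c t)].
Proof.
elim/last_ind: S => [_ _|S t ih].
  have [rays [pairs ht0]] := chart.
  have [|hz bz bzE rz rzE] := rays y.
    by have := @c_near 0; rewrite c0 lexx; apply.
  (* A degenerate segment keeps the chain nonempty and covers the centre. *)
  exists [:: ((dir y).1, (base (dir y), base (dir y)))]; split=> //=.
  - by rewrite c0; split; rewrite //= /seg_ok bz.
  - by rewrite /chain_len big_seq1 /= subrr normr0 mulr0.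
  - move=> t; rewrite inE => /eqP-> s; rewrite c0 ht0 => s0.
    have -> : s = 0 by lra.
    eexists; exists (base (dir y)); split; first exact: mem_head.
      by rewrite /between /= lexx.
    by rewrite ray0.
rewrite rcons_path last_rcons => /andP[pS St] tb.
have lb : last 0 S <= b := le_trans St tb.
have l0 : 0 <= last 0 S.
  have : all (>= 0) (0 :: S) by rewrite /= lexx order_path_min//; exact: le_trans.
  by move=> /allP/(_ _ (mem_last _ _)).
have [l [cl ln ll lcov]] := ih pS lb.
have [||||l' [cl' ll' lcov']] := @star_step l (c (last 0 S)) (c t) (K * (t - last 0 S)).
- by apply: c_near; rewrite l0.
- by apply: c_near; rewrite tb (le_trans l0).
- rewrite -[t - _]ger0_norm ?subr_ge0// distrC; apply: cK; rewrite ?l0 ?lb ?tb//.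
  by rewrite (le_trans l0).
- by apply: lcov; exact: mem_last.
exists (l ++ l'); split.
- exact: is_chain_cat cl cl'.
- by case: (l) ln.
- by rewrite chain_len_cat; lra.
move=> u; rewrite -rcons_cons mem_rcons inE => /predU1P[->//|uS] s hs.
by apply/covers_cat; left; exact: lcov.
Qed.

(** There are finitely many rays. Passing through the positions of [c] at the times [T h] of
    greatest height on each ray, in order of time, covers everything that [c] meets, at a cost that
    telescopes to [K * b]. *)
Lemma local_chain : exists l, [/\ is_chain y l (c b), l != [::], chain_len l <= K * b &
  forall t, 0 <= t <= b -> covers l (c t)].
Proof.
have [rays [pairs ht0]] := chart.
(* Being 0 off the ray makes the height Lipschitz: in a star, changing rays costs the sum of the two
   heights. *)
pose height h t := if dir (c t) == h then ht (c t) else 0.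
have /choice[T TP] h : exists t, 0 <= t <= b /\
    forall s, 0 <= s <= b -> height h s <= height h t.
  have [|t t01 tm] := @lipschitz_max R (height h) K b b0 K0; last by exists t.
  move=> s t s01 t01; rewrite -lee_fin; apply: le_trans (cK s01 t01).
  apply: le_trans (pairs _ _ (c_near s01) (c_near t01)); rewrite lee_fin /height.
  have [hs _ _ _ _] := rays _ (c_near s01).
  have [ht' _ _ _ _] := rays _ (c_near t01).
  have [sh|sh] := eqVneq (dir (c s)) h; have [th|th] := eqVneq (dir (c t)) h.
  - by rewrite sh th eqxx.
  - by rewrite sh eq_sym (negbTE th) subr0 ger0_norm// lerDl.
  - by rewrite th (negbTE sh) sub0r normrN ger0_norm// lerDr.
  - by rewrite subrr normr0; case: ifP => _; rewrite ?addr_ge0.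
pose S := rcons (sort <=%R [seq T h | h <- enum {: gE G * bool}]) b.
have TS t : t \in sort <=%R [seq T h | h <- enum {: gE G * bool}] -> 0 <= t <= b.
  by rewrite mem_sort => /mapP[h _ ->]; case: (TP h).
have pS : path <=%R 0 S.
  rewrite rcons_path; apply/andP; split.
    rewrite path_min_sorted; first exact/sort_sorted/le_total.
    by apply/allP => t /TS /andP[].
  have := mem_last 0 (sort <=%R [seq T h | h <- enum {: gE G * bool}]).
  by rewrite inE => /predU1P[->//|/TS/andP[]].
have [|l [cl ln ll lcov]] := sorted_times_chain pS; first by rewrite last_rcons.
rewrite last_rcons in cl ll; exists l; split=> // t t01.
have [hz bz bzE rz rzE] := rays _ (c_near t01); rewrite -rzE.
have [T01 /(_ t t01)] := TP (dir (c t)); rewrite /height eqxx.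
have TSin : T (dir (c t)) \in 0 :: S.
  by rewrite inE mem_rcons inE mem_sort map_f ?orbT// mem_enum.
case: ifP => [/eqP dE le|_ le].
  by rewrite -dE; apply: (lcov _ TSin); rewrite hz.
(* The curve is off this ray at the time of greatest height, so that height is 0 and [c t] is the
   centre. *)
have -> : ht (c t) = 0 by apply/le_anti; rewrite le.
have := lcov 0 (mem_head _ _) 0; rewrite c0 ht0 lexx => /(_ isT).
have [|_ _ yE _ _] := rays y; first by rewrite -{2}c0; apply: c_near; rewrite lexx.
by rewrite !ray0 yE bzE.
Qed.

End Chart.

Lemma curve_chain (c : R -> point R G) (K : R) : 0 < K ->
  (forall s t, 0 <= s <= 1 -> 0 <= t <= 1 ->
     (pdist 1 (c s) (c t) <= (K * `|s - t|)%:E)%E) ->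
  (forall t, 0 <= t <= 1 -> exists e s, 0 <= s <= 1 /\ c t = edge_point e s) ->
  exists l, [/\ is_chain (c 0) l (c 1), l != [::], chain_len l <= K &
    forall t, 0 <= t <= 1 -> covers l (c t)].
Proof.
move=> K0 cK cE.
pose P u v := exists l, [/\ is_chain (c u) l (c v), l != [::],
    chain_len l <= K * (v - u) & forall t, u <= t <= v -> covers l (c t)].
suff : P 0 1 by rewrite /P subr0 mulr1.
apply: interval_chain_ind => [|u v w _ _|t t01]; first exact: ler01.
  move=> [l [cl ln ll lcov]] [l' [cl' ln' ll' lcov']]; exists (l ++ l'); split.
  - exact: is_chain_cat cl cl'.
  - by case: (l) ln.
  - by rewrite chain_len_cat; lra.
  - move=> t /andP[ut tw]; apply/covers_cat.
    by have [tv|/ltW tv] := leP t v; [left; apply: lcov|right; apply: lcov']; apply/andP.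
have [e [s0 [s01 ctE]]] := cE t t01.
have [rho [dir [base [ht [rho0 chart]]]]] := star_chart_exists e s01.
rewrite -ctE in chart.
exists (rho / K); first by rewrite divr_gt0.
move=> s s01'; rewrite ltr_pdivlMr// => st; split=> ts.
  have [||||l [cl ln ll lcov]] :=
    @local_chain _ _ _ _ _ chart (fun x => c (t + x)) K (s - t) K0.
  - by rewrite subr_ge0.
  - by move: st; rewrite ger0_norm ?subr_ge0// mulrC.
  - by rewrite addr0.
  - move=> x x' xs xs'; have E : t + x - (t + x') = x - x' by lra.
    by rewrite -E; apply: cK; lra.
  exists l; split=> //; first by move: cl; rewrite /= addrC subrK.
  by move=> x xs; have := lcov (x - t); rewrite /= (addrC t) subrK; apply; lra.
(* To the left of [t] the chart is centred at the final point, so the curve is run backwards and the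
   chain reversed. *)
have [||||l [cl ln ll lcov]] := @local_chain _ _ _ _ _ chart (fun x => c (t - x)) K (t - s) K0.
- by rewrite subr_ge0.
- by move: st; rewrite distrC ger0_norm ?subr_ge0// mulrC.
- by rewrite subr0.
- move=> x x' xs xs'; have E : t - x - (t - x') = - (x - x') by lra.
  by rewrite -[`|x - x'|]normrN -E; apply: cK; lra.
exists (rev_chain l); split.
- by apply: is_chain_rev; move: cl; rewrite /= subKr.
- by rewrite -size_eq0 size_rev size_map size_eq0.
- by rewrite chain_len_rev.
- move=> x xs; apply: covers_rev.
  by have := lcov (t - x); rewrite /= subKr; apply; lra.
Qed.

End CurveChain.

(** * The curve that a folding traces on an edge *)

Section EdgeCurves.
Variables (R : realType) (X Y : fin_mgraph) (alpha : R).
Variable m : point R X -> point R Y.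
Hypotheses (alpha0 : 0 < alpha) (mcov : isometric_covering alpha 1 m).

Lemma chain_sum_lipschitz (d : R -> R -> \bar R) (K a : R) r :
  (forall x y, a <= x <= y -> y <= last a r -> (d x y <= (K * (y - x))%:E)%E) ->
  path <%R a r -> (chain_sum d a r <= (K * (last a r - a))%:E)%E.
Proof.
elim: r a => [|b r ih] a /= dK; first by rewrite subrr mulr0.
move=> /andP[ab pr].
have /andP[_ br] := path_lt_bounds pr (mem_head b r).
apply: le_trans (leeD (dK a b _ br) (ih b _ pr)) _.
- by rewrite lexx ltW.
- by move=> x y /andP[bx xy]; apply: dK; rewrite xy (le_trans (ltW ab)).
- by rewrite -EFinD lee_fin; lra.
Qed.

Lemma affine_is_path (e : gE X) (a b : R) : 0 <= a <= 1 -> 0 <= b <= 1 ->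
  is_path alpha (fun u => edge_point e (a + (b - a) * u)).
Proof.
move=> a01 b01 t t01 eps eps0; exists (eps / alpha); split; first by rewrite divr_gt0.
have conv u : 0 <= u <= 1 -> 0 <= a + (b - a) * u <= 1 by move=> u01; nra.
move=> s s01; rewrite ltr_pdivlMr// => st.
apply: le_lt_trans (edge_point_dist_le alpha0 e (conv s s01) (conv t t01)) _.
rewrite lte_fin; apply: le_lt_trans st; rewrite ler_wpM2r ?(ltW alpha0)//.
rewrite opprD addrACA subrr add0r -mulrBr normrM ler_piMl// ler_norml; lra.
Qed.

(** The distance of the images is at most the arc length of the image of the straight path from [s]
    to [t], which the covering makes equal to that of the path itself. *)
Lemma edge_curve_lipschitz (e : gE X) (s t : R) : 0 <= s <= 1 -> 0 <= t <= 1 ->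
  (pdist 1 (m (edge_point e s)) (m (edge_point e t)) <= (alpha * `|s - t|)%:E)%E.
Proof.
move=> s01 t01; pose p (u : R) := edge_point e (s + (t - s) * u).
have conv u : 0 <= u <= 1 -> 0 <= s + (t - s) * u <= 1 by move=> u01; nra.
have -> : edge_point e s = p 0 by rewrite /p mulr0 addr0.
have -> : edge_point e t = p 1 by rewrite /p mulr1 addrC subrK.
have pl : path <%R 0 [:: 1 : R] by rewrite /= ltr01.
have := chain_sum_le_arclen 1 (m \o p) pl erefl; rewrite /= adde0 => /le_trans; apply.
have [_ <-] := mcov; last exact: affine_is_path.
apply: arclen_le => r pr lr.
have := @chain_sum_lipschitz (path_dist alpha p) (alpha * `|s - t|) 0 r _ pr.
rewrite lr subr0 mulr1; apply => x y /andP[x0 xy] y1.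
apply: le_trans (edge_point_dist_le alpha0 e (conv x _) (conv y _)) _.
- lra.
- lra.
rewrite lee_fin opprD addrACA subrr add0r -mulrBr normrM (distrC t) (distrC x).
by rewrite (ger0_norm (x := y - x)) ?subr_ge0//; lra.
Qed.

(** A constant image would have length 0. This rules out that an edge collapses to an isolated
    vertex, where no segment is available. *)
Lemma edge_curve_nonconstant (e : gE X) :
  exists2 t, 0 <= t <= 1 & m (edge_point e t) <> m (edge_point e 0).
Proof.
apply: contrapT => h.
have {}h t : 0 <= t <= 1 -> m (edge_point e t) = m (edge_point e 0).
  by move=> t01; apply: contrapT => ht; apply: h; exists t.
pose p (u : R) := edge_point e (0 + (1 - 0) * u).
have pE u : p u = edge_point e u by rewrite /p add0r subr0 mul1r.
have pp : is_path alpha p by apply: affine_is_path; lra.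
(* The midpoint is inserted because the two ends of a loop are at distance 0. *)
have pl : path <%R 0 [:: 1 / 2; 1 : R] by rewrite /=; apply/and3P; split=> //; lra.
have := chain_sum_le_arclen alpha p pl erefl.
have [_ /(_ p pp) ->] := mcov; rewrite /= adde0 /path_dist !pE.
have dist a b : 0 <= a <= 1 -> 0 <= b <= 1 -> -(1 / 2) <= a - b <= 1 / 2 ->
    pdist alpha (edge_point e a) (edge_point e b) = (`|a - b| * alpha)%:E.
  by move=> a01 b01 ab; rewrite edge_point_dist// ler_norml.
rewrite (dist 0 (1 / 2)); [|lra|lra|lra]; rewrite (dist (1 / 2) 1); [|lra|lra|lra].
apply/negP; rewrite -ltNge; apply: (@le_lt_trans _ _ 0%E).
  apply: arclen_le => r pr lr.
  have := @chain_sum_lipschitz (path_dist 1 (m \o p)) 0 0 r _ pr.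
  rewrite mul0r; apply => x y /andP[x0 xy]; rewrite lr => y1.
  by rewrite /path_dist /= !pE !h ?pdist_xx ?mul0r//; lra.
rewrite -EFinD lte_fin -mulrDl mulr_gt0// ltr_wpDr// normr_gt0 subr_eq0.
by apply/eqP; lra.
Qed.

Lemma edge_curve_chain (e : gE X) : exists l,
  [/\ is_chain (m (edge_point e 0)) l (m (edge_point e 1)), l != [::],
      chain_len l <= alpha & forall t, 0 <= t <= 1 -> covers l (m (edge_point e t))].
Proof.
apply: (@curve_chain R Y (fun t => m (edge_point e t))) => // [s t|t t01].
  exact: edge_curve_lipschitz.
(* Every point of the curve differs from some other one at finite distance, hence lies on an
   edge. *)
have [t1 t101 ne] := edge_curve_nonconstant e.
have far u : 0 <= u <= 1 -> m (edge_point e t) <> m (edge_point e u) ->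
    exists e' s, 0 <= s <= 1 /\ m (edge_point e t) = edge_point e' s.
  move=> u01; apply: (@finite_dist_edge _ _ 1).
  by apply: le_lt_trans (edge_curve_lipschitz e t01 u01) (ltry _).
have [tE|] := pselect (m (edge_point e t) = m (edge_point e 0)); last first.
  by apply: far; rewrite lexx ler01.
by apply: (far t1 t101); rewrite tE => /esym.
Qed.

End EdgeCurves.

(** * Deformation of coordinates and rationality *)

Lemma seq_has_max (R : realType) (s : seq R) x : x \in s ->
  exists2 p, p \in s & forall t, t \in s -> t <= p.
Proof.
elim: s x => // y [|z s] ih x _.
  by exists y; rewrite ?mem_head// => t; rewrite inE => /eqP->.
have [p ps pm] := ih z (mem_head _ _).
have [py|/ltW yp] := leP p y.
  exists y; rewrite ?mem_head// => t; rewrite inE => /predU1P[->//|/pm tp].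
  exact: le_trans py.
exists p; first by rewrite in_cons ps orbT.
by move=> t; rewrite inE => /predU1P[->//|/pm].
Qed.

Lemma seq_has_min (R : realType) (s : seq R) x : x \in s ->
  exists2 p, p \in s & forall t, t \in s -> p <= t.
Proof.
move=> xs; have [|p] := @seq_has_max R [seq - t | t <- s] (- x).
  exact: map_f.
move=> /mapP[t ts ->] tm; exists t => // u us.
by rewrite -lerN2; apply: tm; exact: map_f.
Qed.

(** Since [u] need not be a value of [phi], it gets a stand-in [t], placed relative to [C] as [u] is
    relative to the image of [C]: halfway between the last point mapped to at most [u] and the first
    mapped to at least [u]. These coincide when [u] is the image of a point of [C]. *)
Lemma order_transfer (R : realType) (phi : R -> R) (C : seq R) (a b u : R) :
  {in C &, forall x y, x < y -> phi x < phi y} ->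
  a \in C -> b \in C -> phi a <= u <= phi b ->
  exists t, forall x, x \in C -> (x <= t -> phi x <= u) /\ (t <= x -> u <= phi x).
Proof.
move=> mono aC bC /andP[au ub].
have [|p] := @seq_has_max R [seq x <- C | phi x <= u] a; first by rewrite mem_filter au.
rewrite mem_filter => /andP[pu pC] pm.
have [|q] := @seq_has_min R [seq x <- C | u <= phi x] b; first by rewrite mem_filter ub.
rewrite mem_filter => /andP[uq qC] qm.
have pq : p <= q by rewrite leNgt; apply/negP => /(mono _ _ qC pC); lra.
exists ((p + q) / 2) => x xC; split=> xt.
  rewrite leNgt; apply/negP => ux.
  have qx : q <= x by apply: qm; rewrite mem_filter xC ltW.
  have xp : x = p by lra.
  by move: ux; rewrite xp; lra.
rewrite leNgt; apply/negP => ux.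
have xp : x <= p by apply: pm; rewrite mem_filter xC ltW.
have xq : x = q by lra.
by move: ux; rewrite xq; lra.
Qed.

Section Deformation.
Variables (R : realType) (Y : fin_mgraph) (phi : R -> R).

Definition deform_seg (s : seg R Y) : seg R Y := (s.1, (phi s.2.1, phi s.2.2)).

Definition deform (z : point R Y) : point R Y :=
  if sval z is ME g t then edge_point g (phi t) else z.

Hypotheses (phi0 : phi 0 = 0) (phi1 : phi 1 = 1).

Lemma deform_edge_point g t : 0 <= t <= 1 -> deform (edge_point g t) = edge_point g (phi t).
Proof.
move=> /edge_mpointP[->|->|t01]; rewrite /deform /=.
- by rewrite edge_mpoint0 phi0.
- by rewrite edge_mpoint1 phi1.
- by rewrite edge_mpoint_interior.
Qed.

Lemma deform_chain y l y' : (forall s, s \in l -> seg_ok (deform_seg s)) ->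
  is_chain y l y' -> is_chain (deform y) (map deform_seg l) (deform y').
Proof.
elim: l y => [|s l ih] y /= ok; first by move=> ->.
move=> [/andP[s1 s2] sy c]; split.
- by apply: ok; exact: mem_head.
- by rewrite -sy deform_edge_point.
- rewrite -deform_edge_point//; apply: ih c => u ul.
  by apply: ok; rewrite inE ul orbT.
Qed.

End Deformation.

(* The order relations among finitely many coordinates survive any additive
   [phi] preserving the signs of their differences; lengths, being integer
   combinations of coordinates, are transformed by [phi] itself. *)
Lemma foldable_deformation (R : realType) (X Y : fin_mgraph) (alpha : R) :
  foldable_scale X Y alpha -> exists D : seq R, forall phi : R -> R,
    {morph phi : x y / x + y} -> phi 1 = 1 ->
    (forall x, x \in D -> 0 < x -> 0 < phi x) -> foldable_scale X Y (phi alpha).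
Proof.
move=> [alpha0 [m mcov]].
have /choice[l lP] e := edge_curve_chain alpha0 mcov e.
pose mv v := m (exist (fun x : mpoint R X => mvalid x) (MV R v) isT).
pose coord (z : point R Y) := if sval z is ME _ t then [:: t] else [::].
(* Vertices of [X] may be sent to interior points of edges, whose coordinates must be controlled as
   well. *)
pose C : seq R := [:: 0; 1] ++
  flatten [seq flatten [seq [:: s.2.1; s.2.2] | s : seg R Y <- l e] | e <- enum (gE X)] ++
  flatten [seq coord (mv v) | v <- enum (gV X)].
have C0 : 0 \in C by rewrite !inE eqxx.
have C1 : 1 \in C by rewrite !inE eqxx orbT.
have Cl e s : s \in l e -> s.2.1 \in C /\ s.2.2 \in C.
  move=> sl; suff h x : x \in [:: s.2.1; s.2.2] -> x \in C.
    by split; apply: h; rewrite !inE eqxx ?orbT.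
  move=> xs; rewrite !mem_cat; apply/or3P; constructor 2.
  by apply/flatten_mapP; exists e; rewrite ?mem_enum//; apply/flatten_mapP; exists s.
have Cv v g t : sval (mv v) = ME g t -> t \in C.
  move=> h; rewrite !mem_cat; apply/or3P; constructor 3.
  by apply/flatten_mapP; exists v; rewrite ?mem_enum// /coord h mem_head.
(* Positivity is kept at [alpha] for the new scale, at the slacks so that no chain becomes too long,
   and at the differences so that [phi] is increasing on [C]. *)
exists (alpha :: [seq alpha - chain_len (l e) | e <- enum (gE X)] ++
        [seq y - x | x <- C, y <- C]) => phi phiD phi1 phi_pos.
have phi0 : phi 0 = 0 by apply: (addrI (phi 0)); rewrite -phiD !addr0.
have phiN x : phi (- x) = - phi x.
  by apply: (addrI (phi x)); rewrite -phiD !subrr.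
have phiB x y : phi (x - y) = phi x - phi y by rewrite phiD phiN.
have mono : {in C &, forall x y, x < y -> phi x < phi y}.
  move=> x y xC yC xy; rewrite -subr_gt0 -phiB; apply: phi_pos; rewrite ?subr_gt0//.
  by rewrite inE mem_cat; apply/or3P; constructor 3; apply/allpairsP; exists (x, y).
have monoW : {in C &, forall x y, x <= y -> phi x <= phi y}.
  move=> x y xC yC; rewrite le_eqVlt => /predU1P[->//|xy].
  by rewrite ltW// mono.
have phi_between x y t : x \in C -> y \in C -> t \in C ->
    between x y t -> between (phi x) (phi y) (phi t).
  by move=> xC yC tC /orP[]/andP[h h']; apply/orP; [left|right]; apply/andP;
    split; apply: monoW.
pose l' e := map (deform_seg phi) (l e).
apply: (@foldable_of_chains R X Y _ (fun v => deform phi (mv v)) l').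
- by apply: phi_pos => //; exact: mem_head.
- move=> e; have [cl _ _ _] := lP e.
  have E0 : mv (gends e).1 = m (edge_point e 0).
    by congr m; apply: point_inj; rewrite /= edge_mpoint0.
  have E1 : mv (gends e).2 = m (edge_point e 1).
    by congr m; apply: point_inj; rewrite /= edge_mpoint1.
  rewrite E0 E1; apply: deform_chain => // s sl.
  have [s1 s2] := Cl e s sl; have /andP[s101 s201] := is_chain_ok cl sl.
  have phi01 x : x \in C -> 0 <= x <= 1 -> 0 <= phi x <= 1.
    by move=> xC /andP[x0 x1]; rewrite -{1}phi0 -phi1 !monoW.
  by rewrite /seg_ok /= !phi01.
- by move=> e; have [_ ln _ _] := lP e; rewrite -size_eq0 size_map size_eq0.
- move=> e; have [_ _ ll _] := lP e.
  have -> : chain_len (l' e) = phi (chain_len (l e)).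
    rewrite /chain_len big_map (big_morph phi phiD phi0) !big_seq.
    apply: eq_bigr => s /(Cl e)[s1 s2] /=.
    have [ss|/ltW ss] := leP s.2.1 s.2.2.
      by rewrite !ger0_norm ?subr_ge0 ?monoW// phiB.
    by rewrite !ler0_norm ?subr_le0 ?monoW// !opprB phiB.
  (* A chain without slack has length exactly [alpha], and the equality is carried over by [phi]. *)
  move: ll; rewrite le_eqVlt => /predU1P[->//|ll].
  rewrite -subr_ge0 -phiB ltW//; apply: phi_pos; rewrite ?subr_gt0//.
  by rewrite inE mem_cat; apply/or3P; constructor 2; apply/map_f; rewrite mem_enum.
have [surj _] := mcov.
have cov z : (exists v, mv v = z) \/ exists e, covers (l e) z.
  have [x <-] := surj z; case xE : (sval x) => [v|e t].
    by left; exists v; congr m; apply: point_inj; rewrite xE.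
  have [t01 ->] := sval_ME xE; right; exists e; have [_ _ _ h] := lP e.
  by apply: h; lra.
move=> z; case zE : (sval z) => [w|g u].
  case: (cov z) => [[v vz]|[e [s [t [sl st zst]]]]].
    by left; exists v; rewrite vz /deform zE.
  right; exists e; have [cl _ _ _] := lP e.
  have [s1 s2] := Cl e s sl; have /andP[s101 s201] := is_chain_ok cl sl.
  have t01 : 0 <= t <= 1 by move: st => /orP[]; lra.
  (* A segment meets a vertex only at an end of its edge, and [phi] fixes both end coordinates. *)
  have tE : t = 0 \/ t = 1.
    case/edge_mpointP: t01 => [|| t01]; [by left|by right|].
    by move: zE; rewrite zst /= edge_mpoint_interior.
  exists (deform_seg phi s), t; split=> //; first exact: map_f.
  have -> : t = phi t by case: tE => ->.
  by apply: phi_between => //; case: tE => ->.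
have [/andP[u0 u1] zE'] := sval_ME zE.
have [|t tP] := @order_transfer R phi C 0 1 u mono C0 C1.
  by rewrite phi0 phi1 !ltW.
have t01 : 0 < t < 1.
  apply/andP; split; rewrite ltNge; apply/negP => h.
    by have [_ /(_ h)] := tP _ C0; rewrite phi0; lra.
  by have [/(_ h) + _] := tP _ C1; rewrite phi1; lra.
have gt : sval (edge_point g t) = ME g t by rewrite /= edge_mpoint_interior.
(* If the stand-in is the image of a vertex, then [t] is in [C], which forces [u = phi t]; if a
   segment covers it, its endpoints keep their sides relative to [u]. *)
case: (cov (edge_point g t)) => [[v vz]|[e [s [t' [sl st zst]]]]].
  left; exists v; rewrite /deform vz gt zE'; congr edge_point.
  have tC : t \in C by apply: (Cv v g); rewrite vz.
  have [h h'] := tP t tC.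
  by apply/le_anti; rewrite h// h'.
have [gs tt'] : s.1 = g /\ t' = t by apply: edge_mpoint_ME; rewrite -gt zst.
right; exists e; exists (deform_seg phi s), u; split; first exact: map_f.
  have [/tP[h1 h2] /tP[h3 h4]] := Cl e s sl.
  by move: st; rewrite tt' => /orP[/andP[/h1 a /h4 b]|/andP[/h3 a /h2 b]];
    rewrite /between /= a b ?orbT.
by rewrite /= gs.
Qed.

(* A maximal rational subspace containing [1] but not [alpha] is a hyperplane. *)
Lemma rational_coordinate (R : realType) (alpha : R) :
  (forall q : rat, alpha <> ratr q) ->
  exists Q : R -> rat, [/\ {morph Q : x y / x + y}, Q 1 = 0 & Q alpha = 1].
Proof.
move=> irr.
(* Adjoining the rationals lets the empty chain satisfy the hypothesis of Zorn's lemma, its union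
   being the empty set. *)
pose ext (W : set R) : set R := fun x => W x \/ exists q : rat, x = ratr q.
pose linear (W : set R) := forall x y q, W x -> W y -> W (x + ratr q * y).
pose P (W : set R) := linear (ext W) /\ ~ ext W alpha.
have ext_le (A B : set R) x : A `<=` B -> ext A x -> ext B x.
  by move=> AB [/AB|]; [left|right].
have [F FP Ftot|W [[Wlin Wa] Wmax]] := @Zorn_bigcup R P.
  split; last first.
    move=> [[A FA Aa]|[q aq]]; last exact: (irr q).
    by have [_] := FP _ FA; apply; left.
  move=> x y q [[A FA Ax]|[r xr]] [[B FB By]|[r' yr]].
  - have [AB|BA] := Ftot A B FA FB.
      have [Blin _] := FP _ FB; apply: (@ext_le B); first by move=> u Bu; exists B.
      by apply: Blin; left => //; exact: AB.
    have [Alin _] := FP _ FA; apply: (@ext_le A); first by move=> u Au; exists A.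
    by apply: Alin; left => //; exact: BA.
  - have [Alin _] := FP _ FA; apply: (@ext_le A); first by move=> u Au; exists A.
    by apply: Alin; [left|right; exists r'].
  - have [Blin _] := FP _ FB; apply: (@ext_le B); first by move=> u Bu; exists B.
    by apply: Blin; [right; exists r|left].
  - by right; exists (r + q * r'); rewrite xr yr rmorphD rmorphM.
pose V := ext W.
have V0 : V 0 by right; exists 0; rewrite rmorph0.
have V1 : V 1 by right; exists 1; rewrite rmorph1.
have VZ q x : V x -> V (ratr q * x) by move=> Vx; rewrite -[_ * _]add0r; exact: Wlin.
have VD x y : V x -> V y -> V (x + y).
  by move=> Vx Vy; have := Wlin x y 1 Vx Vy; rewrite rmorph1 mul1r.
have span x : exists q : rat, V (x - ratr q * alpha).
  have [Vx|nVx] := pselect (V x); first by exists 0; rewrite rmorph0 mul0r subr0.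
  (* If [x] is outside [V], maximality puts [alpha] into the span of [V] and [x], with a nonzero
     coefficient at [x]; solving for [x] gives [q]. *)
  pose B : set R := fun u => exists v q, V v /\ u = v + ratr q * x.
  have VB u : V u -> B u by move=> Vu; exists u, 0; rewrite rmorph0 mul0r addr0.
  have extB u : ext B u -> B u by move=> [//|[q uq]]; apply: VB; right; exists q.
  have [Ba|nBa] := pselect (B alpha).
    have [v [q [Vv aE]]] := Ba.
    have q0 : ratr q != 0 :> R.
      by apply/eqP => q0; apply: Wa; move: aE; rewrite q0 mul0r addr0 => ->.
    exists q^-1; have -> : x - ratr q^-1 * alpha = ratr (- q^-1) * v.
      by rewrite aE rmorphN fmorphV; field.
    exact: VZ.
  exfalso; apply: (Wmax B).
    split; first by move=> u Wu; apply: VB; left.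
    move=> BW; apply: nVx; left; apply: BW; exists 0, 1.
    by rewrite rmorph1 mul1r add0r.
  split; last by move=> /extB.
  move=> u w q /extB[v [r [Vv ->]]] /extB[v' [r' [Vv' ->]]]; left.
  exists (v + ratr q * v'), (r + q * r'); split; first by apply: VD => //; exact: VZ.
  by rewrite rmorphD rmorphM /=; ring.
have /choice[Q VQ] := span.
(* Two different coefficients would put a nonzero rational multiple of [alpha], hence [alpha], into
   [V]. *)
have uniq x q : V (x - ratr q * alpha) -> Q x = q.
  move=> Vq; apply: contrapT => /eqP; rewrite -subr_eq0 => qN0.
  have q0 : ratr (Q x - q) != 0 :> R by rewrite fmorph_eq0.
  apply: Wa; have := VZ (Q x - q)^-1 _ (VD _ _ Vq (VZ (-1) _ (VQ x))).
  suff -> : ratr (Q x - q)^-1 * (x - ratr q * alpha + ratr (-1) * (x - ratr (Q x) * alpha))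
     = alpha by [].
  by rewrite fmorphV rmorphN rmorph1; move: q0; rewrite rmorphB /= => q0; field.
exists Q; split.
- move=> x y; apply: uniq.
  have := VD _ _ (VQ x) (VQ y).
  by rewrite rmorphD /= mulrDl opprD addrACA.
- by apply: uniq; rewrite rmorph0 mul0r subr0.
- by apply: uniq; rewrite rmorph1 mul1r subrr.
Qed.

Theorem theorem4 (R : realType) (G1 G2 : fin_mgraph) (alpha : R) :
  foldable_scale G1 G2 alpha ->
  (forall beta : R, foldable_scale G1 G2 beta -> alpha <= beta) ->
  exists q : rat, alpha = ratr q.
Proof.
move=> fold_alpha alpha_min; apply: contrapT => irr.
have [Q [QD Q1 Qa]] : exists Q : R -> rat,
    [/\ {morph Q : x y / x + y}, Q 1 = 0 & Q alpha = 1].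
  by apply: rational_coordinate => q aq; apply: irr; exists q.
have [D deform_fold] := foldable_deformation fold_alpha.
(* For positive [x], [eps * (1 + |Q x|) <= x] gives [eps * Q x < x]; the added 1 makes this strict
   and the quotient well defined. The value 1 elsewhere keeps all bounds positive. *)
pose bound (x : R) := if 0 < x then x / (1 + `|ratr (Q x)|) else 1.
have den x : 0 < 1 + `|ratr (Q x)| :> R by rewrite ltr_pwDl.
have [|eps eps0 eps_le] := @pos_lower_bound R _ D bound.
  by move=> x _; rewrite /bound; case: ifP => // x0; rewrite divr_gt0.
have : alpha <= alpha - eps * ratr (Q alpha).
  apply: alpha_min; apply: (deform_fold (fun x => x - eps * ratr (Q x))).
  - by move=> x y /=; rewrite QD rmorphD /= mulrDr opprD addrACA.
  - by rewrite Q1 rmorph0 mulr0 subr0.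
  - move=> x xD x0; have := eps_le x xD; rewrite /bound x0 ler_pdivlMr// => le_x.
    rewrite subr_gt0; apply: lt_le_trans le_x.
    rewrite ltr_pM2l//; have := ler_norm (ratr (Q x) : R); lra.
by rewrite Qa rmorph1 mulr1; lra.
Qed.
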